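(* For each $1 \le i \le d$, let $f_i \in \mathbb{R}[x]$ be a non-constant polynomial. For Lebesgue-almost every $\lambda \in \mathbb{R}^d$, $$\overline{D}\big(\lambda_1 f_1(\mathbb{Z}) + \cdots + \lambda_d f_d(\mathbb{Z})\big) = \min\left(1, \frac{1}{\deg f_1} + \cdots + \frac{1}{\deg f_d}\right).$$ Moreover, if $\sum_{i=1}^d (\deg f_i)^{-1} \neq 1$, then for Lebesgue-almost every $\lambda \in \mathbb{R}^d$, $$\overline{d}^{\,\min\left(1, \sum_i (\deg f_i)^{-1}\right)}\big(\lambda_1 f_1(\mathbb{Z}) + \cdots + \lambda_d f_d(\mathbb{Z})\big) > 0.$$
   Context: For $\lambda \in \mathbb{R}$ and $A, B \subseteq \mathbb{R}$: $\lambda A = \{\lambda a \mid a \in A\}$, $A + B = \{a+b \mid a \in A, b \in B\}$, and $\lfloor A \rfloor = \{\lfloor a \rfloor \mid a \in A\}$. For $E \subseteq \mathbb{R}$ and $\alpha \ge 0$, the $\alpha$-mass measure of $E$ is $$\overline{d}^{\,\alpha}(E) = \limsup_{\ell\to\infty} \frac{|\lfloor E \rfloor \cap [-\ell,\ell)|}{(2\ell)^\alpha},$$ and the (upper) mass dimension of $E$ is $\overline{D}(E) = \inf\{\alpha \ge 0 \mid \overline{d}^{\,\alpha}(E) = 0\}$. *)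

(* Defs.v *)
From mathcomp Require Export all_boot all_order all_algebra.
From mathcomp Require Export finmap.
From mathcomp Require Export all_classical all_reals all_analysis.

Set Implicit Arguments.
Unset Strict Implicit.
Unset Printing Implicit Defensive.

Import Order.TTheory GRing.Theory Num.Theory.
Import numFieldNormedType.Exports.

Local Open Scope classical_set_scope.
Local Open Scope ring_scope.

(* Lebesgue measure on R^d (restricted to Borel sets), as the d-fold product
   of the Lebesgue measure on R; R^0 carries the unit point mass. *)
Fixpoint lebesgue_tuple (R : realType) (d : nat) :
    set (d.-tuple (measurableTypeR R)) -> \bar R :=
  match d with
  | 0 => \d_([tuple])
  | d'.+1 => pushforward (lebesgue_measure \x @lebesgue_tuple R d')%E
               (fun p : measurableTypeR R * d'.-tuple (measurableTypeR R) =>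
                  [tuple of p.1 :: p.2])
  end.

Definition scale_set (R : realType) (c : R) (A : set R) : set R :=
  [set c * a | a in A].

Definition sum_set (R : realType) (A B : set R) : set R :=
  [set a + b | a in A & b in B].

Definition floor_set (R : realType) (A : set R) : set int :=
  [set Num.floor a | a in A].

Definition int_window (R : realType) (l : R) : set int :=
  [set n : int | - l <= n%:~R < l].

(* [fset_set] computes the true cardinality here: integer points of a bounded
   interval form a finite set.  The limsup is over real l. *)
Definition mass_measure (R : realType) (alpha : R) (E : set R) : \bar R :=
  limf_esup
    (fun l : R =>
       ((#|` fset_set (floor_set E `&` int_window l)|)%:R
          / (2 * l) `^ alpha)%:E)
    (pinfty_nbhs R).

(* The set below contains every alpha > 1 and is bounded below by 0, so the
   real-valued [inf] is its genuine infimum. *)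
Definition mass_dimension (R : realType) (E : set R) : R :=
  inf [set alpha : R | 0 <= alpha /\ mass_measure alpha E = 0%E].

Definition poly_values (R : realType) (p : {poly R}) : set R :=
  [set p.[n%:~R] | n in [set: int]].

(* lambda_1 f_1(Z) + ... + lambda_d f_d(Z) *)
Definition poly_sumset (R : realType) (d : nat)
    (f : 'I_d -> {poly R}) (lambda : d.-tuple R) : set R :=
  \big[@sum_set R/[set 0]]_(i < d)
     scale_set (tnth lambda i) (poly_values (f i)).

(* 1 / deg f_1 + ... + 1 / deg f_d; the degree of a nonzero p is
   (size p).-1. *)
Definition sum_inv_deg (R : realType) (d : nat) (f : 'I_d -> {poly R}) : R :=
  \sum_(i < d) ((size (f i)).-1)%:R^-1.

(* Main.v *)
From HB Require Import structures.
Require Import Defs.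
From mathcomp Require Import measurable_realfun zify ring lra.

Set Implicit Arguments.
Unset Strict Implicit.
Unset Printing Implicit Defensive.

Import Order.TTheory GRing.Theory Num.Theory.
Import numFieldNormedType.Exports.
Local Open Scope classical_set_scope.
Local Open Scope ring_scope.

(** Let [k_i] be the degree of [f_i], [s] the sum of the [1 / k_i], and write
    [t . f(n)] for [t_1 f_1(n_1) + ... + t_d f_d(n_d)].  Both bounds are first
    moment computations over the parameters [t] of a box [[-K, K]^d].

    For [L >= 1], the slab of the [t] with [|t . y| <= L] has measure
    [O(L / max(1, |y_i|))] for every [i]: integrate the variable [t_i] first.
    Interpolating between these bounds and the trivial one, its measure is
    [O(L^a prod_i max(1, |y_i|)^(- b_i))] whenever [b_i >= 0] and
    [a = sum_i b_i <= 1] ([lebesgue_tuple_slab_prod]); in this form sums over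
    integer vectors factor into sums over one coordinate.  On the other hand, by
    Fatou's lemma, a sequence of nonnegative functions with bounded integrals is
    bounded along a subsequence at almost every point
    ([ae_frequently_bounded_indic]).

    Upper bound.  If [s >= 1], there are at most [O(l)] integers in [[-l, l)].
    Suppose that [s < 1].  The difficulty is that [t . f(n)] may be small although
    the [f_i(n_i)] are large.  Apply the slab bound to [y_i = f_i(n_i)] with
    [b_i = g / k_i] and [g] slightly larger than 1: the sums of the
    [max(1, |f_i(n)|)^(- b_i)] over the integers converge, so the expected number
    of [n] with [|t . f(n)| <= L] is [O(L^(g s))].  Summing this over the scales
    [L = 2^j] against the weights [L^(- a)], where [g s < a], controls all scales
    at once for almost every [t], and the dimension is at most [a]
    ([ae_mass_dimension_le]).

    Lower bound.  At scale [N], let [n_i] run over about [N^(1 / k_i)] consecutive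
    integers taken in a range where [|f_i(n) - f_i(m)| >= c |n - m|^k_i].  The
    slab bound with [L = 1], [y_i = f_i(n_i) - f_i(m_i)], [b_i = g / k_i] and
    [g s <= 1] bounds the expected number of pairs with [|t . (f(n) - f(m))| <= 1]
    by [O(N^(s (1 + tau)))], where [tau = max(0, 1 - g)] is the growth exponent of
    the sums of [j^(- g)], [g] being different from 1.  There are at least [N^s]
    vectors, so by Cauchy-Schwarz their values have at least a constant times
    [N^(s (1 - tau))] distinct floors, all of size [O(N)], for infinitely many [N]
    ([ae_mass_measure_gt0]).  The exponent [s (1 - tau)] equals [min(1, s)] for
    [g = 2 - s] when [s < 1] and for [g = 1 / s] when [s > 1].  When [s = 1] every
    [g < 1] is allowed, which yields all exponents below 1: this gives the
    dimension but not the positivity of the measure. *)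

(** * The product Lebesgue measure on tuples *)

Section cons_measure.
Context (R : realType) (d : nat).
Local Notation T := (measurableTypeR R).
Variable m : {sigma_finite_measure set (d.-tuple T) -> \bar R}.

Let cons_pair (p : T * d.-tuple T) : d.+1.-tuple T := [tuple of p.1 :: p.2].
Let uncons (t : d.+1.-tuple T) : T * d.-tuple T := (tnth t ord0, [tuple of behead t]).

Let measurable_cons_pair : measurable_fun setT cons_pair.
Proof. exact: measurable_cons. Qed.

Let measurable_uncons : measurable_fun setT uncons.
Proof.
apply/measurable_fun_pairP; split; first exact: measurable_tnth.
exact: measurable_behead.
Qed.

Let cons_pairK : cancel cons_pair uncons.
Proof. by case=> x t; rewrite /uncons tnth0; congr pair; apply/val_inj. Qed.

(** The recursion step of [lebesgue_tuple], kept as a separate constant so that it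
    can carry the structure of a sigma-finite measure. *)
Definition cons_measure := pushforward (lebesgue_measure \x m)%E cons_pair.

HB.instance Definition _ := Measure.copy cons_measure
  (measure_function_pushforward__canonical__measure_function_Measure
     (lebesgue_measure \x m)%E measurable_cons_pair).

Let cons_measure_sigma_finite : sigma_finite setT cons_measure.
Proof.
pose lm : {sigma_finite_measure set T -> \bar R} := lebesgue_measure.
have /sigma_finiteP[F [FT ndF Foo]] := sigma_finiteT lm.
have /sigma_finiteP[G [GT ndG Goo]] := sigma_finiteT m.
exists (fun n => uncons @^-1` (F n `*` G n)).
  rewrite -preimage_bigcup; apply/esym/seteqP; split=> //= t _ /=.
  have [n _ Fn] : (\bigcup_n F n) (uncons t).1 by rewrite -FT.
  have [k _ Gk] : (\bigcup_n G n) (uncons t).2 by rewrite -GT.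
  exists (maxn n k) => //; split.
    by move: (uncons t).1 Fn; exact/subsetPset/ndF/leq_maxl.
  by move: (uncons t).2 Gk; exact/subsetPset/ndG/leq_maxr.
move=> n; have [mF muF] := Foo n; have [mG muG] := Goo n.
have mFG : measurable (F n `*` G n) by exact: measurableX.
split; first by rewrite -[X in measurable X]setTI; exact: measurable_uncons.
rewrite /cons_measure /pushforward [X in (_ \x _)%E X](_ : _ = F n `*` G n).
  by rewrite product_measure1E// lte_mul_pinfty// ge0_fin_numE.
rewrite -comp_preimage (_ : uncons \o cons_pair = id) ?preimage_id//.
exact/funext/cons_pairK.
Qed.

HB.instance Definition _ :=
  Measure_isSigmaFinite.Build _ _ _ cons_measure cons_measure_sigma_finite.

End cons_measure.

(** [lebesgue_tuple] is defined as a mere set function; this is what gives access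
    to the theory of sigma-finite measures and to Fubini's theorem. *)
Lemma lebesgue_tuple_measure (R : realType) (d : nat) :
  exists m : {sigma_finite_measure set (d.-tuple (measurableTypeR R)) -> \bar R},
    @lebesgue_tuple R d = m.
Proof.
elim: d => [|d [m IH]] /=; first by exists \d_([tuple]).
by exists (cons_measure m); rewrite IH.
Qed.

(** * Measure of slabs in a box *)

Lemma integral_le_support d (T : measurableType d) (R : realType)
    (mu : {measure set T -> \bar R}) (D : set T) (g : T -> \bar R) (C : R) :
  measurable D -> measurable_fun setT g -> (forall x, 0 <= g x)%E ->
  (forall x, D x -> g x <= C%:E)%E -> (forall x, ~ D x -> g x = 0%E) ->
  (\int[mu]_x g x <= C%:E * mu D)%E.
Proof.
move=> mD mg g0 gC gD.
have -> : (\int[mu]_x g x = \int[mu]_(x in D) g x)%E.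
  rewrite [RHS]integral_mkcond; apply: eq_integral => x _.
  rewrite patchE; case: ifPn => // /negP xD.
  by apply: gD => Dx; apply: xD; rewrite inE.
rewrite -integral_cst//; apply: ge0_le_integral => //.
exact: measurable_funS mg.
Qed.

Section cons_measure_le.
Context (R : realType) (d : nat).
Local Notation T := (measurableTypeR R).
Variable m : {sigma_finite_measure set (d.-tuple T) -> \bar R}.

Lemma measurable_cons_preimage (A : set (d.+1.-tuple T)) : measurable A ->
  measurable ((fun p : T * d.-tuple T => [tuple of p.1 :: p.2]) @^-1` A).
Proof.
by move=> mA; rewrite -[X in measurable X]setTI; exact: measurable_cons.
Qed.

(** Integrating the tail first, which is how the product measure is defined. *)
Lemma cons_measure_le_head (A : set (d.+1.-tuple T)) (D : set T) (C : R) :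
  measurable A -> measurable D ->
  (forall t, A t -> D (tnth t ord0)) ->
  (forall x, D x -> m [set t : d.-tuple T | A [tuple of x :: t]] <= C%:E)%E ->
  (cons_measure m A <= C%:E * @lebesgue_measure R D)%E.
Proof.
move=> mA mD AD AC; have mcA := measurable_cons_preimage mA.
have xE x : xsection ((fun p : T * d.-tuple T => [tuple of p.1 :: p.2]) @^-1` A) x
    = [set t : d.-tuple T | A [tuple of x :: t]] by rewrite xsectionE.
apply: integral_le_support => //.
- exact: measurable_fun_xsection.
- by move=> x Dx /=; rewrite xE; exact: AC.
- move=> x Dx /=; rewrite xE [X in m X](_ : _ = set0) ?measure0//.
  by apply/seteqP; split=> // t /= /AD; rewrite tnth0.
Qed.

(** Integrating the head first: the two iterated integrals agree by uniqueness of
    the product measure. *)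
Lemma cons_measure_le_tail (A : set (d.+1.-tuple T)) (D : set (d.-tuple T)) (C : R) :
  measurable A -> measurable D ->
  (forall t, A t -> D [tuple of behead t]) ->
  (forall t, D t -> @lebesgue_measure R [set x | A [tuple of x :: t]] <= C%:E)%E ->
  (cons_measure m A <= C%:E * m D)%E.
Proof.
move=> mA mD AD AC; have mcA := measurable_cons_preimage mA.
have yE t : ysection ((fun p : T * d.-tuple T => [tuple of p.1 :: p.2]) @^-1` A) t
    = [set x | A [tuple of x :: t]] by rewrite ysectionE.
pose lm : {sigma_finite_measure set T -> \bar R} := lebesgue_measure.
rewrite /cons_measure /pushforward.
rewrite (@product_measure_unique _ _ _ _ _ lm m (lm \x^ m)%E)//; last first.
  by move=> X Y mX mY; exact: product_measure2E.
apply: integral_le_support => //.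
- exact: measurable_fun_ysection.
- by move=> x Dx /=; rewrite yE; exact: AC.
- move=> t Dt /=; rewrite yE [X in lebesgue_measure X](_ : _ = set0) ?measure0//.
  apply/seteqP; split=> // x /= /AD; rewrite (_ : [tuple of _] = t)//.
  exact/val_inj.
Qed.

End cons_measure_le.

Definition box (R : realType) (d : nat) (K : R) : set (d.-tuple (measurableTypeR R)) :=
  [set t | forall i, `|tnth t i| <= K].
Arguments box {R} d K.

(** The constant [c] stands for the contribution of the coordinates that have been
    fixed, in the induction on the dimension. *)
Definition slab (R : realType) (d : nat) (K c L : R) (y : 'I_d -> R) :
    set (d.-tuple (measurableTypeR R)) :=
  box d K `&` [set t | `|c + \sum_(i < d) tnth t i * y i| <= L].

Section slab.
Context (R : realType).
Local Notation T := (measurableTypeR R).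

Lemma measurable_box d (K : R) : measurable (box d K).
Proof.
rewrite (_ : box d K = \bigcap_(i in [set: 'I_d])
    ((fun t : d.-tuple T => tnth t i) @^-1` `[- K, K]%classic)).
  apply: fin_bigcap_measurable => // i _; rewrite -[X in measurable X]setTI.
  by apply: (@measurable_tnth _ T d i) => //; exact: measurable_itv.
by apply/seteqP; split=> t /= tK i => [_|]; have := tK i;
  rewrite /= in_itv /= -ler_norml //; apply.
Qed.

Lemma measurable_slab d (K c L : R) (y : 'I_d -> R) : measurable (slab K c L y).
Proof.
apply: measurableI; first exact: measurable_box.
pose h := fun t : d.-tuple T => c + \sum_(i < d) tnth t i * y i.
have mh : measurable_fun setT h.
  apply: measurable_funD => //; apply: measurable_sum => i.
  by apply: measurable_funM => //; exact: measurable_tnth.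
rewrite (_ : [set _ | _] = h @^-1` `[- L, L]%classic); last first.
  by apply/seteqP; split=> t /=; rewrite in_itv /= -ler_norml.
by rewrite -[X in measurable X]setTI; apply: mh => //; exact: measurable_itv.
Qed.

Lemma lebesgue_measure_interval (K : R) : 0 <= K ->
  @lebesgue_measure R [set x : R | `|x| <= K] = (2 * K)%:E.
Proof.
move=> K0; rewrite (_ : [set x : R | _] = [set` `[- K, K]]); last first.
  by apply/seteqP; split=> x /=; rewrite in_itv /= ler_norml.
rewrite lebesgue_measure_itv /= lte_fin; case: ltrP => KK.
  by rewrite -EFinB; congr EFin; lra.
by congr EFin; lra.
Qed.

(** If [|y| <= 1] the bound is the length of [[-K, K]]; otherwise the set lies in an
    interval of length [2 L / |y|].  The constant covers both cases as [L >= 1]. *)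
Lemma lebesgue_measure_slab1 (K c L y : R) : 0 <= K -> 1 <= L ->
  (@lebesgue_measure R [set x : R | `|x| <= K /\ `|c + x * y| <= L]%R <=
   ((2 * K + 2) * (L / Num.max 1 `|y|))%:E)%E.
Proof.
move=> K0 L1.
have mC (a b : R) : measurable [set x : T | `|a + x * b| <= L].
  rewrite (_ : [set _ | _] = (fun x : T => a + x * b) @^-1` `[- L, L]%classic).
    rewrite -[X in measurable X]setTI.
    have mf : measurable_fun setT (fun x : T => a + x * b).
      by apply: measurable_funD => //; apply: measurable_funM.
    by apply: mf => //; exact: measurable_itv.
  by apply/seteqP; split=> t /=; rewrite in_itv /= -ler_norml.
have mB : measurable [set x : T | `|x| <= K].
  rewrite (_ : [set x : R | _] = [set` `[- K, K]]); first exact: measurable_itv.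
  by apply/seteqP; split=> x /=; rewrite in_itv /= ler_norml.
have mI : measurable [set x : T | `|x| <= K /\ `|c + x * y| <= L].
  exact: (measurableI _ _ mB (mC c y)).
have [y1|y1] := leP `|y| 1.
  rewrite divr1; apply: (@le_trans _ _ (2 * K)%:E); last first.
    rewrite lee_fin. have : 0 <= (K + 1) * (L - 1) by rewrite mulr_ge0; lra. lra.
  rewrite -lebesgue_measure_interval//; apply: le_measure; rewrite ?inE//.
  by move=> x [].
have y0 : 0 < `|y| by lra.
apply: (@le_trans _ _ (2 * (L / `|y|))%:E); last first.
  rewrite lee_fin ler_wpM2r//; last by lra.
  by rewrite divr_ge0//; lra.
rewrite (_ : (2 * (L / `|y|))%:E =
    @lebesgue_measure R [set` `[- c / y - L / `|y|, - c / y + L / `|y|]]); last first.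
  rewrite lebesgue_measure_itv /= lte_fin ifT.
    by rewrite -EFinB; congr EFin; lra.
  have : 0 < L / `|y| by rewrite divr_gt0//; lra.
  lra.
apply: le_measure; rewrite ?inE//.
move=> x [_ /= xL]; rewrite in_itv /=; rewrite -ler_distl.
rewrite -(ler_pM2r y0) divfK ?gt_eqF// -normrM mulrBl.
by rewrite divfK ?opprK 1?[x * y + c]addrC// -normr_gt0.
Qed.

Lemma slab_cons d (K c L : R) (y : 'I_d.+1 -> R) x (t : d.-tuple T) :
  slab K c L y [tuple of x :: t] <->
  `|x| <= K /\ slab K (c + x * y ord0) L (y \o lift ord0) t.
Proof.
rewrite /slab /box /= big_ord_recl /= !(tnth0,addrA).
under eq_bigr do rewrite tnthS.
split=> [[tK ->]|[xK [tK ->]]].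
  split; first by have := tK ord0; rewrite tnth0.
  by split=> // i; have := tK (lift ord0 i); rewrite tnthS.
split=> // i; case: (unliftP ord0 i) => [j ->|->]; last by rewrite tnth0.
by rewrite tnthS.
Qed.

Lemma box_cons d (K : R) x (t : d.-tuple T) :
  box d.+1 K [tuple of x :: t] <-> `|x| <= K /\ box d K t.
Proof.
rewrite /box /=; split=> [tK|[xK tK] i].
  split; first by have := tK ord0; rewrite tnth0.
  by move=> i; have := tK (lift ord0 i); rewrite tnthS.
by case: (unliftP ord0 i) => [j ->|->]; rewrite ?tnth0// tnthS.
Qed.

Lemma lebesgue_tuple_box d (K : R) : 0 <= K ->
  (@lebesgue_tuple R d (box d K) <= ((2 * K + 2) ^+ d)%:E)%E.
Proof.
move=> K0; elim: d => [|d IH].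
  by rewrite /= diracE expr0 lee_fin; case: (_ \in _).
have [m mE] := lebesgue_tuple_measure R d.
have -> : @lebesgue_tuple R d.+1 = cons_measure m by rewrite /= mE.
apply: (@le_trans _ _ (((2 * K + 2) ^+ d)%:E *
    @lebesgue_measure R [set x : R | `|x| <= K]%R)%E).
  apply: cons_measure_le_head.
  - exact: measurable_box.
  - rewrite (_ : [set x : R | _] = [set` `[- K, K]]); first exact: measurable_itv.
    by apply/seteqP; split=> x /=; rewrite in_itv /= ler_norml.
  - by move=> t; apply.
  - move=> x xK; rewrite (_ : [set t | _] = box d K) -?mE//.
    by apply/seteqP; split=> t /=; [move/box_cons => []|move=> bt; apply/box_cons].
rewrite lebesgue_measure_interval// -EFinM lee_fin exprS mulrC.
by rewrite ler_wpM2r ?exprn_ge0//; lra.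
Qed.

(** Induction on the dimension, with [c] arbitrary: the coordinate [i] is either the
    head, which is then integrated first, or a coordinate of the tail, where the
    induction hypothesis holds uniformly in the head. *)
Lemma lebesgue_tuple_slab d (K c L : R) (y : 'I_d -> R) (i : 'I_d) :
  0 <= K -> 1 <= L ->
  (@lebesgue_tuple R d (slab K c L y) <=
    ((2 * K + 2) ^+ d * (L / Num.max 1 `|y i|))%:E)%E.
Proof.
move=> K0 L1; elim: d => [|d IH] in c y i *; first by case: i.
have K2 : 0 <= 2 * K + 2 by lra.
have q0 z : 0 <= L / Num.max 1 `|z|.
  by rewrite divr_ge0 ?le_max ?ler01//; lra.
have [m mE] := lebesgue_tuple_measure R d.
have -> : @lebesgue_tuple R d.+1 = cons_measure m by rewrite /= mE.
have tK (t : d.+1.-tuple T) : slab K c L y t -> `|tnth t ord0| <= K /\ 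
    slab K (c + tnth t ord0 * y ord0) L (y \o lift ord0) [tuple of behead t].
  rewrite {1}(tuple_eta t) => /slab_cons; rewrite (_ : thead t = tnth t ord0)//.
case: (unliftP ord0 i) => [j ->|->].
  apply: (@le_trans _ _ (((2 * K + 2) ^+ d * (L / Num.max 1 `|y (lift ord0 j)|))%:E *
      @lebesgue_measure R [set x : R | `|x| <= K]%R)%E).
    apply: cons_measure_le_head.
    - exact: measurable_slab.
    - rewrite (_ : [set x : R | _] = [set` `[- K, K]]); first exact: measurable_itv.
      by apply/seteqP; split=> x /=; rewrite in_itv /= ler_norml.
    - by move=> t /tK[].
    - move=> x xK; rewrite (_ : [set t | _] =
        slab K (c + x * y ord0) L (y \o lift ord0)).
        by rewrite -mE; exact: IH.
      by apply/seteqP; split=> t /=; [move/slab_cons => []|move=> bt; apply/slab_cons].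
  rewrite lebesgue_measure_interval// -EFinM lee_fin exprS mulrC -mulrA.
  by rewrite ler_wpM2r ?mulr_ge0 ?exprn_ge0//; lra.
apply: (@le_trans _ _ (((2 * K + 2) * (L / Num.max 1 `|y ord0|))%:E * m (box d K))%E).
  apply: cons_measure_le_tail.
  - exact: measurable_slab.
  - exact: measurable_box.
  - by move=> t /tK[_ []].
  - move=> t tbK; pose c' := c + \sum_(k < d) tnth t k * y (lift ord0 k).
    apply: le_trans (lebesgue_measure_slab1 c' (y ord0) K0 L1).
    rewrite [X in (lebesgue_measure X <= _)%E](_ : _ =
      [set x : R | `|x| <= K /\ `|c' + x * y ord0| <= L])//.
    apply/seteqP; split=> x /=; rewrite /c' addrAC; first by move/slab_cons => [? []].
    by move=> [? ?]; apply/slab_cons.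
rewrite -mE; apply: le_trans (lee_wpmul2l _ (lebesgue_tuple_box _ K0)) _.
  by rewrite lee_fin mulr_ge0.
by rewrite -EFinM lee_fin exprS mulrAC.
Qed.

End slab.

(** * Product bound for slabs, and an averaging principle *)

Lemma ler_powRl (R : realType) (r x y : R) :
  0 <= r -> 0 <= x -> x <= y -> x `^ r <= y `^ r.
Proof.
move=> r0 x0 xy; apply: (@ge0_ler_powR R r r0) => //; rewrite nnegrE//.
exact: le_trans xy.
Qed.

Lemma powR_sumr (R : realType) (I : Type) (r : seq I) (P : pred I) (x : R)
    (b : I -> R) :
  0 < x -> x `^ (\sum_(i <- r | P i) b i) = \prod_(i <- r | P i) x `^ b i.
Proof.
move=> x0; elim/big_rec2: _ => [|i y z _ <-]; first by rewrite powRr0.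
by rewrite powRD// (gt_eqF x0) implybT.
Qed.

(** The relative measure [x] of the slab is at most 1 and at most
    [L / max(1, |y_i|)] for each [i], hence
    [x <= x ^ (sum_i b_i) = prod_i x ^ b_i <= prod_i (L / max(1, |y_i|)) ^ b_i]. *)
Lemma lebesgue_tuple_slab_prod (R : realType) d (K L : R) (y b : 'I_d -> R) :
  0 <= K -> 1 <= L -> (forall i, 0 <= b i) -> \sum_(i < d) b i <= 1 ->
  (@lebesgue_tuple R d (slab K 0 L y) <=
    ((2 * K + 2) ^+ d * (L `^ (\sum_(i < d) b i) *
       \prod_(i < d) Num.max 1 `|y i| `^ (- b i)))%:E)%E.
Proof.
move=> K0 L1 b0 b1; set C := (2 * K + 2) ^+ d.
have C0 : 0 < C by rewrite exprn_gt0//; lra.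
have [m mE] := lebesgue_tuple_measure R d.
have : (m (slab K 0 L y) <= C%:E)%E.
  rewrite -mE; apply: le_trans (lebesgue_tuple_box _ K0).
  rewrite mE; apply: le_measure; rewrite ?inE.
  - exact: measurable_slab.
  - exact: measurable_box.
  - by move=> t [].
have := fun i => lebesgue_tuple_slab 0 y i K0 L1.
have : (0 <= m (slab K 0 L y))%E by exact: measure_ge0.
rewrite mE -/C; case: (m _) => [M| |//]; last by move=> _ _; rewrite leye_eq.
rewrite !lee_fin => M0 Mi MC.
rewrite -ler_pdivrMl//; set x := C^-1 * M.
have x1 : x <= 1 by rewrite ler_pdivrMl// mulr1.
have xi i : x <= L / Num.max 1 `|y i| by rewrite ler_pdivrMl// -lee_fin Mi.
have mx i : 0 < Num.max 1 `|y i| :> R by rewrite lt_max ltr01.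
have L0 : 0 < L by lra.
have : 0 <= x by rewrite mulr_ge0// invr_ge0 ltW.
rewrite le_eqVlt => /predU1P[<-|x0].
  by rewrite mulr_ge0 ?powR_ge0// prodr_ge0// => i _; rewrite powR_ge0.
apply: (@le_trans _ _ (x `^ (\sum_(i < d) b i))).
  by apply: ger1_powR => //; rewrite x0.
rewrite !powR_sumr// -big_split /=; apply: ler_prod => i _.
rewrite powR_ge0 /=.
have -> : Num.max 1 `|y i| `^ (- b i) = (Num.max 1 `|y i|)^-1 `^ b i.
  by rewrite -powR_inv1 ?ltW// -powRrM mulN1r.
by rewrite -powRM ?invr_ge0 ?(ltW (mx i)) ?(ltW L0)// ler_powRl// ltW.
Qed.

Section fatou.
Context d (T : measurableType d) (R : realType) (mu : {measure set T -> \bar R}).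

(** By Fatou's lemma the lower limit of the sequence is integrable, hence finite
    almost everywhere. *)
Lemma ae_frequently_bounded (h : nat -> T -> R) (C : R) :
  (forall n, measurable_fun setT (h n)) -> (forall n x, 0 <= h n x) ->
  (forall n, \int[mu]_x (h n x)%:E <= C%:E)%E ->
  {ae mu, forall x, exists c : R, forall N, exists2 n, (N <= n)%N & h n x <= c}.
Proof.
move=> mh h0 hC; pose u x n := (h n x)%:E.
have mu' n : measurable_fun setT (u^~ n) by exact/measurable_EFinP.
pose F x := limn_einf (u x).
have mF : measurable_fun setT F.
  apply: measurableT_comp => //; apply: measurable_fun_limn_esup => n.
  exact: measurableT_comp.
have F0 x : (0 <= F x)%E.
  rewrite /F limn_einf_lim; apply: lime_ge; first exact: is_cvg_einfs.
  by apply: nearW => n; apply: le_ereal_inf_tmp => _ [k _ <-]; rewrite lee_fin.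
have FC : (\int[mu]_x F x <= C%:E)%E.
  apply: le_trans; first by apply: (fatou mu measurableT mu') => n x _; rewrite lee_fin.
  rewrite limn_einf_lim; apply: lime_le; first exact: is_cvg_einfs.
  apply: nearW => n; apply: le_trans (hC n).
  by apply: ereal_inf_lbound; exists n => /=.
have iF : mu.-integrable setT F.
  apply/integrableP; split=> //.
  under eq_integral do rewrite gee0_abs//.
  exact: le_lt_trans FC (ltry _).
have := integrable_ae measurableT iF; apply: filterS => x /(_ I) Ffin.
exists (fine (F x) + 1) => N.
have : (einfs (u x) N < (fine (F x) + 1)%:E)%E.
  apply: (@le_lt_trans _ _ (F x)).
    rewrite /F limn_einf_lim.
    rewrite (cvg_lim _ (@cvg_einfs_sup _ (u x)))//.
    by apply: ereal_sup_ubound; exists N.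
  by rewrite EFinD fineK// lteDl.
move/ereal_inf_lt => [_ [n /= Nn <-]]; rewrite lte_fin => /ltW hn.
by exists n.
Qed.

Lemma ae_frequently_bounded_indic (I : nat -> finType) (w b : forall n, I n -> R)
    (A : forall n, I n -> set T) (C : R) :
  (forall n p, 0 <= w n p) -> (forall n p, measurable (A n p)) ->
  (forall n p, mu (A n p) <= (b n p)%:E)%E ->
  (forall n, \sum_(p : I n) w n p * b n p <= C) ->
  {ae mu, forall x, exists c : R, forall N,
    exists2 n, (N <= n)%N & \sum_(p : I n) w n p * \1_(A n p) x <= c}.
Proof.
move=> w0 mA muA wC.
apply: (@ae_frequently_bounded (fun n x => \sum_(p : I n) w n p * \1_(A n p) x) C).
- move=> n; apply: measurable_sum => p; apply: measurable_funM => //.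
- by move=> n x; apply: sumr_ge0 => p _; rewrite mulr_ge0.
move=> n; under eq_integral do rewrite -sumEFin.
rewrite ge0_integral_sum//=; last 2 first.
- move=> p; apply/measurable_EFinP; exact: measurable_funM.
- by move=> p x _; rewrite lee_fin mulr_ge0.
apply: (@le_trans _ _ (\sum_(p : I n) (w n p * b n p)%:E)%E); last first.
  by rewrite sumEFin lee_fin.
apply: lee_sum => p _; under eq_integral do rewrite EFinM.
rewrite ge0_integralZl ?lee_fin//; last exact/measurable_EFinP.
by rewrite integral_indic// setIT EFinM lee_wpmul2l ?lee_fin.
Qed.

End fatou.

(** * Growth of polynomials at integers *)

Section power_differences.
Context (R : realFieldType).
Implicit Types x y : R.

Lemma subrX_ge x y k : 0 <= y <= x -> x ^+ k * (x - y) <= x ^+ k.+1 - y ^+ k.+1.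
Proof.
move=> /andP[y0 yx]; have : y * y ^+ k <= y * x ^+ k.
  by rewrite ler_wpM2l// lerXn2r ?nnegrE// (le_trans y0).
by rewrite !exprS; nra.
Qed.

Lemma subrX_le x y i : 0 <= y <= x ->
  x * (x ^+ i - y ^+ i) <= i%:R * (x ^+ i * (x - y)).
Proof.
move=> /andP[y0 yx]; have x0 : 0 <= x by exact: le_trans yx.
elim: i => [|i IH]; first by rewrite !expr0; lra.
have P0 : 0 <= i%:R * (x ^+ i * (x - y)) by rewrite !mulr_ge0 ?exprn_ge0// subr_ge0.
have P1 : y * (x * (x ^+ i - y ^+ i)) <= y * (i%:R * (x ^+ i * (x - y))).
  by rewrite ler_wpM2l.
have P2 : y * (i%:R * (x ^+ i * (x - y))) <= x * (i%:R * (x ^+ i * (x - y))).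
  by rewrite ler_wpM2r.
have -> : x * (x ^+ i.+1 - y ^+ i.+1) =
    x * (x ^+ i * (x - y)) + y * (x * (x ^+ i - y ^+ i)) by rewrite !exprS; ring.
have -> : i.+1%:R * (x ^+ i.+1 * (x - y)) =
    x * (x ^+ i * (x - y)) + x * (i%:R * (x ^+ i * (x - y))).
  by rewrite exprS -natr1; ring.
lra.
Qed.

(** The differences of lower powers are smaller by a factor [x], up to a constant:
    for large [x] the leading term of a polynomial dominates its increments. *)
Lemma subrX_lower x y i k : (i <= k)%N -> 1 <= x -> 0 <= y <= x ->
  x * (x ^+ i - y ^+ i) <= k.+1%:R * (x ^+ k.+1 - y ^+ k.+1).
Proof.
move=> ik x1 xy; have /andP[y0 yx] := xy.
apply: le_trans (subrX_le i xy) _.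
have xik : x ^+ i <= x ^+ k by rewrite ler_weXn2l.
have ik' : i%:R <= k.+1%:R :> R by rewrite ler_nat ltnW.
apply: ler_pM => //; first by rewrite mulr_ge0 ?exprn_ge0 ?subr_ge0//; lra.
by apply: le_trans (subrX_ge k xy); rewrite ler_wpM2r// subr_ge0.
Qed.

Lemma exprB_le x y k : 0 <= y <= x -> (x - y) ^+ k.+1 <= x ^+ k.+1 - y ^+ k.+1.
Proof.
move=> xy; have /andP[y0 yx] := xy; apply: le_trans (subrX_ge k xy).
rewrite exprSr ler_wpM2r ?subr_ge0//.
by rewrite lerXn2r ?nnegrE ?subr_ge0//; lra.
Qed.

End power_differences.

Section polynomial_growth.
Context (R : realType).
Implicit Types p : {poly R}.

(** Beyond [n0] the lower order terms contribute at most half of the increment of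
    the leading term, which is at least [|lead| (x - y)^k].  Only the larger of the
    two points has to be large. *)
Lemma poly_diff_growth p : (1 < size p)%N ->
  exists n0 : nat, exists2 c : R, 0 < c & forall x y : R, 0 <= y <= x ->
    n0%:R <= x -> c * (x - y) ^+ (size p).-1 <= `|p.[x] - p.[y]|.
Proof.
case E : (size p) => [//|[//|k]] _ /=.
pose a := p`_k.+1; have a0 : 0 < `|a|.
  by rewrite normr_gt0 /a -[k.+1]/(k.+2.-1) -E lead_coef_eq0 -size_poly_eq0 E.
pose S := \sum_(i < k.+1) `|p`_i|.
have S0 : 0 <= S by apply: sumr_ge0.
pose B := 2 * S * k.+1%:R / `|a|.
exists (Num.truncn B).+2, (`|a| / 2); first by rewrite divr_gt0.
move=> x y xy n0x; have /andP[y0 yx] := xy.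
have Bx : B <= x.
  by apply: le_trans n0x; apply: le_trans (ltW (truncnS_gt B)) _; rewrite ler_nat.
have x1 : 1 <= x by apply: le_trans n0x; rewrite ler1n.
set D := x ^+ k.+1 - y ^+ k.+1.
have D0 : 0 <= D by rewrite subr_ge0 lerXn2r ?nnegrE//; lra.
have -> : p.[x] - p.[y] = a * D + \sum_(i < k.+1) p`_i * (x ^+ i - y ^+ i).
  rewrite !horner_coef E !(big_ord_recr k.+1)/= /D /a.
  under [X in _ = _ + X]eq_bigr do rewrite mulrBr.
  by rewrite sumrB; ring.
set r := (\sum_(_ < _) _ in X in _ <= X).
have xr : x * `|r| <= S * (k.+1%:R * D).
  rewrite -{1}(ger0_norm (_ : 0 <= x)); last by lra.
  rewrite -normrM /r mulr_sumr; apply: le_trans (ler_norm_sum _ _ _) _.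
  rewrite /S mulr_suml; apply: ler_sum => i _.
  rewrite mulrCA normrM ler_wpM2l// ger0_norm.
    by apply: subrX_lower => //; rewrite -ltnS.
  by rewrite mulr_ge0 ?subr_ge0 ?lerXn2r ?nnegrE//; lra.
have rD : `|r| <= `|a| / 2 * D.
  have x0 : 0 < x by lra.
  rewrite -(ler_pM2l x0); apply: le_trans xr _.
  have : B * (`|a| / 2 * D) <= x * (`|a| / 2 * D).
    by rewrite ler_wpM2r// mulr_ge0 ?divr_ge0.
  apply: le_trans; rewrite le_eqVlt; apply/orP; left; apply/eqP.
  rewrite /B; field; exact: lt0r_neq0.
apply: (@le_trans _ _ (`|a| / 2 * D)).
  by rewrite ler_wpM2l ?divr_ge0// exprB_le.
have := lerB_normD (a * D) r; rewrite normrM (ger0_norm D0); lra.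
Qed.

Lemma poly_le_growth p : exists2 C : R, 0 < C &
  forall x : R, 0 <= x -> `|p.[x]| <= C * (1 + x) ^+ (size p).-1.
Proof.
exists (1 + \sum_(i < size p) `|p`_i|).
  by rewrite ltr_wpDr// sumr_ge0.
move=> x x0; rewrite horner_coef; apply: le_trans (ler_norm_sum _ _ _) _.
have x1 : 1 <= 1 + x by lra.
rewrite mulrDl mul1r mulr_suml ler_wpDl ?exprn_ge0//; first lra.
apply: ler_sum => i _; rewrite normrM ler_wpM2l// normrX ger0_norm//.
apply: (@le_trans _ _ ((1 + x) ^+ i)); first by rewrite lerXn2r ?nnegrE//; lra.
by rewrite ler_weXn2l// -ltnS (ltn_predK (ltn_ord i)).
Qed.

Lemma poly_pair_growth p : (1 < size p)%N ->
  exists n0 : nat, exists2 c : R, 0 < c & forall a b : nat,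
    c * (1 + `|a%:R - b%:R|) ^+ (size p).-1 <=
    Num.max 1 `|p.[(n0 + a)%:R] - p.[(n0 + b)%:R]|.
Proof.
move=> /poly_diff_growth [n0 [c c0 H]]; exists n0; set k := (size p).-1 in H *.
have k2 : 0 < 2 ^+ k :> R by rewrite exprn_gt0.
exists (Num.min 1 c / 2 ^+ k); first by rewrite divr_gt0// lt_min ltr01.
have cc : Num.min 1 c <= 1 /\ Num.min 1 c <= c by rewrite !ge_min !lexx orbT.
have c'0 : 0 < Num.min 1 c by rewrite lt_min ltr01.
move: cc c'0; set c' := Num.min 1 c => -[c'1 c'c] c'0.
suff W a b : (a <= b)%N -> c' / 2 ^+ k * (1 + `|a%:R - b%:R|) ^+ k <=
    Num.max 1 `|p.[(n0 + a)%:R] - p.[(n0 + b)%:R]|.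
  move=> a b; case: (leqP a b) => [|/ltnW] ab; first exact: W.
  by rewrite distrC [X in Num.max 1 X]distrC; exact: W.
rewrite leq_eqVlt => /predU1P[->|ab].
  rewrite subrr normr0 addr0 expr1n mulr1 le_max; apply/orP; left.
  rewrite ler_pdivrMr// mul1r (le_trans c'1)//.
  by rewrite exprn_ege1// ler1n.
rewrite le_max; apply/orP; right; rewrite distrC [leRHS]distrC.
have ab1 : 1 <= b%:R - a%:R :> R by rewrite lerBrDl natr1 ler_nat.
rewrite ger0_norm; last by lra.
apply: (@le_trans _ _ (c' * (b%:R - a%:R) ^+ k)).
  rewrite -mulrA ler_wpM2l ?(ltW c'0)// ler_pdivrMl// -exprMn.
  by rewrite lerXn2r ?nnegrE//; lra.
apply: (@le_trans _ _ (c * (b%:R - a%:R) ^+ k)).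
  by rewrite ler_wpM2r ?exprn_ge0//; lra.
have -> : b%:R - a%:R = (n0 + b)%:R - (n0 + a)%:R :> R by rewrite !natrD; ring.
apply: H; first by rewrite ler0n ler_nat leq_add2l ltnW.
by rewrite ler_nat leq_addr.
Qed.

(** Case [y = 0] of the growth of increments, the constant being lowered to cover
    the finitely many small [n]. *)
Lemma poly_nat_growth p : (1 < size p)%N ->
  exists2 c : R, 0 < c & forall n : nat,
    c * (1 + n%:R) ^+ (size p).-1 <= Num.max 1 `|p.[n%:R]|.
Proof.
move=> /poly_diff_growth [n0 [c c0 H]]; set k := (size p).-1 in H *.
have k2 : 0 < 2 ^+ k :> R by rewrite exprn_gt0.
have nk : 0 < n0.+2%:R ^+ k :> R by rewrite exprn_gt0.
pose q := 1 + `|p.[0]|.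
have q0 : 0 < q by rewrite ltr_pwDl.
pose c1 := c / q / 2 ^+ k.
have c10 : 0 < c1 by rewrite !divr_gt0.
pose c2 := (n0.+2%:R ^+ k)^-1 : R.
have c20 : 0 < c2 by rewrite invr_gt0.
exists (Num.min c1 c2); first by rewrite lt_min c10.
move=> n; have [nn|nn] := leqP n n0.
  rewrite le_max; apply/orP; left.
  apply: (@le_trans _ _ (c2 * n0.+2%:R ^+ k)); last by rewrite mulVf ?gt_eqF.
  have nn2 : 1 + n%:R <= n0.+2%:R :> R by rewrite nat1r ler_nat ltnS leqW.
  have n10 : 0 <= 1 + n%:R :> R by rewrite addr_ge0.
  apply: (@le_trans _ _ (c2 * (1 + n%:R) ^+ k)).
    by rewrite ler_wpM2r ?exprn_ge0// ge_min lexx orbT.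
  by rewrite (ler_wpM2l (ltW c20))// lerXn2r ?nnegrE.
have n1 : 1 <= n%:R :> R by rewrite ler1n; exact: leq_ltn_trans nn.
have := H n%:R 0; rewrite lexx ler0n subr0 ler_nat (ltnW nn) => /(_ isT isT) Hn.
have Hq : c * n%:R ^+ k <= Num.max 1 `|p.[n%:R]| * q.
  apply: le_trans Hn _; apply: le_trans (ler_normB _ _) _.
  rewrite /q mulrDr mulr1 lerD ?le_max ?lexx ?orbT//.
  by rewrite ler_peMl// le_max lexx.
rewrite -ler_pdivrMr// in Hq.
apply: le_trans Hq.
apply: (@le_trans _ _ (c1 * (1 + n%:R) ^+ k)).
  by rewrite ler_wpM2r ?exprn_ge0 ?addr_ge0// ge_min lexx.
rewrite /c1 [leRHS]mulrAC -mulrA ler_wpM2l ?divr_ge0// ?(ltW c0) ?(ltW q0)//.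
rewrite ler_pdivrMl// -exprMn lerXn2r ?nnegrE ?addr_ge0 ?mulr_ge0//; lra.
Qed.

Lemma poly_int_growth p : (1 < size p)%N ->
  exists2 c : R, 0 < c & forall n : int,
    c * (1 + `|n%:~R|) ^+ (size p).-1 <= Num.max 1 `|p.[n%:~R]|.
Proof.
move=> p1; have [c c0 Hc] := poly_nat_growth p1.
have sN : size (p \Po - 'X) = size p.
  by rewrite size_comp_poly2// size_polyN size_polyX.
have [c' c'0 Hc'] := @poly_nat_growth (p \Po - 'X) (etrans (congr1 _ sN) p1).
rewrite sN in Hc'.
exists (Num.min c c'); first by rewrite lt_min c0.
case=> n.
  apply: le_trans (Hc n); rewrite -pmulrn ger0_norm//.
  by rewrite ler_wpM2r ?exprn_ge0 ?addr_ge0// ge_min lexx.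
have := Hc' n.+1; rewrite horner_comp !hornerE.
rewrite NegzE rmorphN /= -pmulrn normrN normr_nat.
apply: le_trans; by rewrite ler_wpM2r ?exprn_ge0 ?addr_ge0// ge_min lexx orbT.
Qed.

End polynomial_growth.

(** * Power sums *)

Section power_sums.
Context (R : realType).

Lemma powR_ge_tangent (y b : R) : 0 < y -> 1 + b * ln y <= y `^ b.
Proof. by move=> y0; rewrite /powR gt_eqF// expR_ge1Dx. Qed.

(** Since [y ^ b >= 1 + b ln y] and [ln ((n + 1) / n) >= 1 / (n + 1)]. *)
Lemma powR_ratio_ge (n : nat) (b : R) : (0 < n)%N -> 0 <= b ->
  (1 + b / n.+1%:R) * n%:R `^ b <= n.+1%:R `^ b.
Proof.
move=> n0 b0; have N0 : 0 < n%:R :> R by rewrite ltr0n.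
have S0 : 0 < n.+1%:R :> R by rewrite ltr0n.
have y0 : 0 < n.+1%:R / n%:R :> R by rewrite divr_gt0.
rewrite -[X in _ <= X `^ b](divfK (lt0r_neq0 N0)).
rewrite [leRHS]powRM ?(ltW y0) ?(ltW N0)// ler_wpM2r ?powR_ge0//.
apply: le_trans (powR_ge_tangent _ y0); rewrite lerD2l ler_wpM2l//.
rewrite -[_ / _ in leRHS]invrK lnV ?posrE ?invr_gt0//.
rewrite invf_div lerNr.
have -> : n%:R / n.+1%:R = 1 + - n.+1%:R^-1 :> R.
  apply: (mulIf (lt0r_neq0 S0)); rewrite mulrDl mul1r mulNr.
  by rewrite mulVf ?divfK ?lt0r_neq0// -natr1 addrK.
by apply: le_ln1Dx; rewrite ltrN2 invf_lt1// ltr1n.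
Qed.

Lemma powR_sub1r (x a : R) : 0 < x -> x `^ (a - 1) = x `^ a / x.
Proof.
by move=> x0; rewrite powRB ?(gt_eqF x0) ?implybT// powRr1// ltW.
Qed.

(** With [powR_diff_lt1], this makes the sums of [j ^ (- g)] telescope. *)
Lemma powR_diff_gt1 (g : R) (n : nat) : 1 < g -> (0 < n)%N ->
  (g - 1) * n.+1%:R `^ (- g) <= n%:R `^ (1 - g) - n.+1%:R `^ (1 - g).
Proof.
move=> g1 n0; have S0 : 0 < n.+1%:R :> R by rewrite ltr0n.
have N0 : 0 < n%:R :> R by rewrite ltr0n.
have -> : n.+1%:R `^ (- g) = n.+1%:R `^ (1 - g) / n.+1%:R :> R.
  by rewrite -powR_sub1r//; congr (_ `^ _); ring.
have := @powR_ratio_ge n (g - 1) n0 (_ : 0 <= g - 1).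
rewrite subr_ge0 => /(_ (ltW g1)).
have -> : 1 - g = - (g - 1) by ring.
rewrite !powRN; set u := n%:R `^ _; set v := n.+1%:R `^ _ => uv.
have u0 : 0 < u by rewrite powR_gt0.
have v0 : 0 < v by rewrite powR_gt0.
have : (1 + (g - 1) / n.+1%:R) / v <= u^-1.
  by rewrite ler_pdivrMr// ler_pdivlMl// mulrC.
rewrite mulrDl mul1r.
have -> : (g - 1) * (v^-1 / n.+1%:R) = (g - 1) / n.+1%:R / v by ring.
by rewrite lerBrDl.
Qed.

Lemma powR_diff_lt1 (g : R) (n : nat) : 0 < g -> g < 1 ->
  (1 - g) / 2 * n.+1%:R `^ (- g) <= n.+1%:R `^ (1 - g) - n%:R `^ (1 - g).
Proof.
move=> g0 g1; have S0 : 0 < n.+1%:R :> R by rewrite ltr0n.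
have -> : n.+1%:R `^ (- g) = n.+1%:R `^ (1 - g) / n.+1%:R :> R.
  by rewrite -powR_sub1r//; congr (_ `^ _); ring.
have a0 : 0 < 1 - g by rewrite subr_gt0.
have a1 : 1 - g <= 1 by lra.
set a := 1 - g in a0 a1 *.
case: n S0 => [|n] S0.
  by rewrite powR0 ?gt_eqF// powR1 /= divr1; lra.
have := @powR_ratio_ge n.+1 a (ltn0Sn _) (ltW a0).
set u := n.+1%:R `^ a; set v := n.+2%:R `^ a; set s := n.+2%:R^-1 => uv.
have v0 : 0 < v by rewrite powR_gt0.
have s0 : 0 < s by rewrite invr_gt0.
have s1 : a * s <= 1.
  have : s <= 1 by rewrite invf_le1// ler1n.
  by move=> ?; rewrite mulr_ile1// ltW.
have as0 : 0 < a * s by rewrite mulr_gt0.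
have u0 : 0 <= u by rewrite powR_ge0.
have asu : 0 <= a * s * u by rewrite mulr_ge0// ltW.
have vu : 0 <= v - u by lra.
have : a * s * (v - u) <= v - u by rewrite ler_piMl.
have -> : a / 2 * (v * s) = a * s * v / 2 by ring.
lra.
Qed.

Lemma power_sum_le (g : R) : 0 < g -> g != 1 -> exists2 C : R, 0 < C &
  forall M : nat, \sum_(j < M) (1 + j%:R) `^ (- g) <=
    C * M%:R `^ (Num.max 0 (1 - g)).
Proof.
move=> g0 gn1; have [g1|g1] := ltP 1 g.
  have -> : Num.max 0 (1 - g) = 0 by apply/max_idPl; lra.
  exists (g / (g - 1)); first by rewrite divr_gt0// subr_gt0.
  move=> M; rewrite powRr0 mulr1.
  have g10 : 0 < g - 1 by rewrite subr_gt0.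
  have C1 : 1 <= g / (g - 1) by rewrite ler_pdivlMr//; lra.
  case: M => [|M]; first by rewrite big_ord0; lra.
  suff : \sum_(j < M.+1) (1 + j%:R) `^ (- g) <=
      g / (g - 1) - M.+1%:R `^ (1 - g) / (g - 1).
    have : 0 <= M.+1%:R `^ (1 - g) / (g - 1) by rewrite divr_ge0 ?powR_ge0// ltW.
    lra.
  elim: M => [|M IH].
    rewrite big_ord1 addr0 !powR1 le_eqVlt; apply/orP; left; apply/eqP.
    by field; exact: lt0r_neq0.
  rewrite big_ord_recr /= nat1r.
  have := powR_diff_gt1 g1 (ltn0Sn M); rewrite mulrC -ler_pdivlMr// mulrBl; lra.
have {}g1 : g < 1 by rewrite lt_neqAle gn1.
have -> : Num.max 0 (1 - g) = 1 - g by apply/max_idPr; lra.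
have a0 : 0 < (1 - g) / 2 by lra.
exists ((1 - g) / 2)^-1; first by rewrite invr_gt0.
move=> M; rewrite mulrC ler_pdivlMr//.
elim: M => [|M IH]; first by rewrite big_ord0 mul0r powR_ge0.
rewrite big_ord_recr /= mulrDl nat1r.
have := powR_diff_lt1 M g0 g1; lra.
Qed.

Lemma sum_eq_le1 (M : nat) (h : nat -> nat) (c : nat) : injective h ->
  \sum_(b < M) (h b == c)%:R <= 1 :> R.
Proof.
move=> hI; have [/existsP[b /eqP hb]|] := boolP [exists b : 'I_M, h b == c].
  rewrite (bigD1 b)//= hb eqxx big1 ?addr0// => i /negPf ib.
  by rewrite -hb (inj_eq hI) (_ : _ == _ = false).
rewrite negb_exists => /forallP nb; rewrite big1 ?ler01// => i _.
by rewrite (negPf (nb i)).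
Qed.

(** For a given [a], each distance is attained by at most two values of [b]. *)
Lemma pair_distance_sum_le (M : nat) (w : nat -> R) : (forall j, 0 <= w j) ->
  \sum_(a < M) \sum_(b < M) w `|a - b|%N <= 2 * M%:R * \sum_(j < M) w j.
Proof.
move=> w0; suff W (a : 'I_M) : \sum_(b < M) w `|a - b|%N <= 2 * \sum_(j < M) w j.
  apply: le_trans (ler_sum _ (fun a _ => W a)) _.
  by rewrite sumr_const card_ord -[leLHS]mulr_natl mulrCA mulrA.
(* The distance j occurs for b = a - j and for b = a + j. *)
apply: (@le_trans _ _ (\sum_(b < M) \sum_(j < M)
    w j * ((b + j == a)%N%:R + (b == a + j :> nat)%N%:R))).
  apply: ler_sum => b _.
  have dM : (`|a - b| < M)%N by have := ltn_ord a; have := ltn_ord b; lia.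
  rewrite (bigD1 (Ordinal dM))//= -[leLHS]addr0 lerD//; last first.
    by apply: sumr_ge0 => j _; rewrite mulr_ge0.
  rewrite -[leLHS]mulr1 ler_wpM2l//.
  have : (b + `|a - b| == a)%N || (b == a + `|a - b| :> nat)%N by lia.
  by case: eqP => _ /=; [rewrite lerDl | move=> ->; rewrite add0r].
rewrite exchange_big /= mulr_sumr; apply: ler_sum => j _.
rewrite -mulr_sumr mulrC ler_wpM2r// big_split /= -[2]/(1 + 1) lerD//.
  apply: (@sum_eq_le1 M (fun b => b + j)%N a) => x y /eqP.
  by rewrite eqn_add2r => /eqP.
exact: (@sum_eq_le1 M id).
Qed.

End power_sums.

(** * Sumsets, floor counts and mass dimension *)

Section mass.
Context (R : realType).
Implicit Types (E : set R) (l a c : R).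

Definition linear_form d (f : 'I_d -> {poly R}) (lambda : d.-tuple R)
    (z : 'I_d -> int) : R :=
  \sum_(i < d) tnth lambda i * (f i).[(z i)%:~R].

Lemma big_sum_setP d (A : 'I_d -> set R) x :
  (\big[@sum_set R/[set 0]]_(i < d) A i) x <->
  exists2 a : 'I_d -> R, (forall i, A i (a i)) & x = \sum_(i < d) a i.
Proof.
elim: d => [|d IH] in A x *.
  rewrite big_ord0; split=> [->|[a _ ->]]; last by rewrite big_ord0.
  by exists (fun=> 0); [case | rewrite big_ord0].
rewrite big_ord_recl; split.
  move=> [u Au [v /IH[a Aa ->] <-]].
  exists (fun i => oapp a u (unlift ord0 i)).
    by move=> i; case: (unliftP ord0 i) => [j ->|->].
  rewrite big_ord_recl unlift_none; congr (_ + _).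
  by apply: eq_bigr => i _; rewrite liftK.
move=> [a Aa ->]; rewrite big_ord_recl.
exists (a ord0) => //; exists (\sum_(i < d) a (lift ord0 i)) => //.
by apply/IH; exists (fun i => a (lift ord0 i)).
Qed.

Lemma poly_sumsetP d (f : 'I_d -> {poly R}) (lambda : d.-tuple R) x :
  poly_sumset f lambda x <-> exists z, x = linear_form f lambda z.
Proof.
rewrite /poly_sumset; split.
  move/big_sum_setP => [a Aa ->].
  have /choice[z Hz] : forall i, exists n : int, a i = tnth lambda i * (f i).[n%:~R].
    by move=> i; have [_ [n _ <-] <-] := Aa i; exists n.
  by exists z; apply: eq_bigr.
move=> [z ->]; apply/big_sum_setP.
exists (fun i => tnth lambda i * (f i).[(z i)%:~R]) => // i.
by exists (f i).[(z i)%:~R] => //; exists (z i).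
Qed.

Let window_enum (m : nat) : seq int := [seq Posz k - Posz m | k <- iota 0 (2 * m)].

Lemma int_window_sub l n : int_window l n -> n \in window_enum (Num.truncn l).+1.
Proof.
move=> /andP[nl ln]; set m := (Num.truncn l).+1.
have lm : l < m%:R by exact: truncnS_gt.
have : - m%:Z%:~R < n%:~R :> R by apply: lt_le_trans nl; rewrite ltrN2 -pmulrn.
rewrite -rmorphN /= ltr_int => nm.
have : n%:~R < m%:Z%:~R :> R by rewrite -pmulrn; exact: lt_trans lm.
rewrite ltr_int => mn; apply/mapP.
exists (absz (n + Posz m)); last lia.
by rewrite mem_iota; lia.
Qed.

Lemma finite_floor_window E l : finite_set (floor_set E `&` int_window l).
Proof.
apply: (@sub_finite_set _ _ [set` window_enum (Num.truncn l).+1]).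
  by move=> n [_ /int_window_sub].
exact: finite_seq.
Qed.

Definition floor_count E l : nat := #|` fset_set (floor_set E `&` int_window l)|.

Lemma mem_floor_window E l n :
  (n \in fset_set (floor_set E `&` int_window l)) <-> (floor_set E `&` int_window l) n.
Proof.
rewrite in_fset_set; last exact: finite_floor_window.
by split; [move/set_mem | move/mem_set].
Qed.

Lemma floor_count_ge E l (s : seq int) : uniq s ->
  (forall n, n \in s -> (floor_set E `&` int_window l) n) ->
  (size s <= floor_count E l)%N.
Proof.
move=> us sE; rewrite /floor_count cardfE.
rewrite -cardfE; apply: uniq_leq_size => // n ns.
exact/mem_floor_window/sE.
Qed.

Lemma floor_count_trivial E l : 1 <= l -> (floor_count E l)%:R <= 4 * l.
Proof.
move=> l1; pose m := (Num.truncn l).+1.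
apply: (@le_trans _ _ (2 * m)%:R).
  rewrite ler_nat /floor_count.
  set F := fset_set _.
  have := @uniq_leq_size _ (enum_fset F) (window_enum m) (fset_uniq F).
  rewrite size_map size_iota; apply => n nF.
  by have /mem_floor_window[_ /int_window_sub] := nF.
rewrite natrM; have : m%:R <= l + 1 :> R.
  by rewrite /m -natr1 lerD2r truncn_le//; lra.
lra.
Qed.

Lemma mass_measureE a E : mass_measure a E =
  limf_esup (fun l : R => ((floor_count E l)%:R / (2 * l) `^ a)%:E) (pinfty_nbhs R).
Proof. by []. Qed.

Lemma mass_ratio_ge0 a E l : (0 <= ((floor_count E l)%:R / (2 * l) `^ a)%:E)%E.
Proof. by rewrite lee_fin divr_ge0 ?powR_ge0. Qed.

Lemma mass_measure_ge0 a E : (0 <= mass_measure a E)%E.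
Proof.
rewrite mass_measureE; apply: limf_esup_ge0; last exact: mass_ratio_ge0.
by move=> [M [_ /(_ (M + 1))]]; apply; rewrite ltrDl.
Qed.

Lemma mass_measure_gt0 a E (delta : R) : 0 < delta ->
  (forall M : R, exists2 l, M < l & delta <= (floor_count E l)%:R / (2 * l) `^ a) ->
  (0 < mass_measure a E)%E.
Proof.
move=> d0 H; apply: (@lt_le_trans _ _ delta%:E); first by rewrite lte_fin.
rewrite mass_measureE limf_esupE; apply: le_ereal_inf_tmp => _ [V [M [_ MV]] <-].
have [l Ml dl] := H M.
apply: (@le_trans _ _ ((floor_count E l)%:R / (2 * l) `^ a)%:E).
  by rewrite lee_fin.
by apply: ereal_sup_ubound; exists l => //; exact: MV.
Qed.

Lemma mass_measure_le0 a E :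
  (forall eps : R, 0 < eps -> exists M : R, forall l, M < l ->
    (floor_count E l)%:R / (2 * l) `^ a <= eps) -> mass_measure a E = 0%E.
Proof.
move=> H; apply/eqP; rewrite eq_le mass_measure_ge0 andbT.
apply/lee_addgt0Pr => eps /H[M HM]; rewrite add0e.
rewrite mass_measureE limf_esupE.
apply: (@le_trans _ _ (ereal_sup
    ((fun l : R => ((floor_count E l)%:R / (2 * l) `^ a)%:E) @` [set l | M < l]))).
  apply: ereal_inf_lbound; exists [set l | M < l] => //; exists M.
  by split; rewrite ?num_real.
by apply: ge_ereal_sup => _ [l Ml <-]; rewrite lee_fin; exact: HM.
Qed.

(** Since [(2 l) ^ a' >= l ^ a'], the ratio is at most [c l ^ (a - a')]. *)
Lemma mass_measure_eq0 a a' c E : a < a' -> 0 <= c ->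
  (forall l, 1 <= l -> (floor_count E l)%:R <= c * l `^ a) ->
  0 <= a -> mass_measure a' E = 0%E.
Proof.
move=> aa' c0 H a0; apply: mass_measure_le0 => eps e0.
have b0 : 0 < a' - a by rewrite subr_gt0.
pose q := c / eps + 1; have q0 : 0 < q by rewrite ltr_wpDl// divr_ge0// ltW.
exists (Num.max 1 (q `^ (a' - a)^-1)) => l; rewrite gt_max => /andP[l1 ql].
have l0 : 0 < l by lra.
have p0 : 0 < (2 * l) `^ a' by rewrite powR_gt0// mulr_gt0.
rewrite ler_pdivrMr//; apply: le_trans (H _ (ltW l1)) _.
have -> : c * l `^ a = c / eps * eps * l `^ a by rewrite divfK// gt_eqF.
rewrite mulrAC [leRHS]mulrC ler_wpM2r// ?(ltW e0)//.
apply: (@le_trans _ _ (l `^ (a' - a) * l `^ a)); last first.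
  rewrite -powRD; last by rewrite (gt_eqF l0) implybT.
  by rewrite subrK ler_powRl//; lra.
rewrite ler_wpM2r ?powR_ge0//.
apply: (@le_trans _ _ q); first by rewrite /q; lra.
rewrite -[q](powRr1 (ltW q0)) -(mulVf (lt0r_neq0 b0)) powRrM.
by rewrite ler_powRl ?powR_ge0// ltW.
Qed.

Lemma mass_measure_gt1 a E : 1 < a -> mass_measure a E = 0%E.
Proof.
move=> a1; apply: (@mass_measure_eq0 1 a 4) => // l l1.
by rewrite powRr1; [exact: floor_count_trivial | lra].
Qed.

Lemma mass_dimension_le a c E : 0 <= a -> 0 <= c ->
  (forall l, 1 <= l -> (floor_count E l)%:R <= c * l `^ a) ->
  mass_dimension E <= a.
Proof.
move=> a0 c0 H; apply/ler_addgt0Pr => eps e0.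
apply: ge_inf; first by exists 0 => x /= [].
split; first by rewrite addr_ge0// ltW.
by apply: (@mass_measure_eq0 a _ c) => //; rewrite ltrDl.
Qed.

Lemma mass_dimension_le1 E : mass_dimension E <= 1.
Proof.
apply: (@mass_dimension_le 1 4) => // l l1.
by rewrite powRr1; [exact: floor_count_trivial | lra].
Qed.

(** For [2 l >= 1] the ratios decrease with the exponent, so no exponent below [a]
    has measure zero; the exponent 2 shows that the infimum is
    over a nonempty set. *)
Lemma mass_dimension_ge a E : (0 < mass_measure a E)%E -> a <= mass_dimension E.
Proof.
move=> aE; apply: lb_le_inf.
  by exists 2; split=> //; apply: mass_measure_gt1; lra.
move=> b [b0 Eb]; rewrite leNgt; apply/negP => ba.
suff : (mass_measure a E <= 0)%E by rewrite leNgt aE.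
rewrite -Eb !mass_measureE !limf_esupE.
apply: le_ereal_inf_tmp => _ [V [M [Mr MV]] <-].
pose W := [set l : R | Num.max 1 M < l].
apply: (@le_trans _ _ (ereal_sup
    ((fun l : R => ((floor_count E l)%:R / (2 * l) `^ a)%:E) @` W))).
  apply: ereal_inf_lbound; exists W => //; exists (Num.max 1 M).
  by split; rewrite ?num_real.
apply: ge_ereal_sup => _ [l Wl <-].
move: Wl; rewrite /W /= gt_max => /andP[l1 Ml].
apply: (@le_trans _ _ ((floor_count E l)%:R / (2 * l) `^ b)%:E).
  rewrite lee_fin ler_wpM2l// lef_pV2 ?posrE ?powR_gt0//; try lra.
  by apply: ler_powR; [lra | exact: ltW].
by apply: ereal_sup_ubound; exists l => //; exact: MV.
Qed.

End mass.

(** Cauchy-Schwarz for the sizes [r y] of the fibres of [phi], which sum to the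
    number of points and whose squares sum to the number of collisions. *)
Lemma card_sqr_le_collisions (R : realFieldType) (T : finType) (P : pred T) (V : eqType)
    (phi : T -> V) :
  (\sum_(a | P a) 1) ^+ 2 <= (size (undup [seq phi a | a <- enum P]))%:R *
    \sum_(a | P a) \sum_(b | P b) (phi a == phi b)%:R :> R.
Proof.
set s := undup _; pose r (y : V) : R := \sum_(a | P a) (phi a == y)%:R.
have phis a : P a -> phi a \in s.
  by move=> Pa; rewrite mem_undup map_f// mem_enum.
have sel (F : V -> R) a : P a -> \sum_(y <- s) (phi a == y)%:R * F y = F (phi a).
  move=> Pa; rewrite (bigD1_seq (phi a)) ?undup_uniq ?phis//= eqxx mul1r.
  by rewrite big1 ?addr0// => y /negPf; rewrite eq_sym => ->; rewrite mul0r.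
have sum_r : \sum_(y <- s) r y = \sum_(a | P a) 1.
  rewrite exchange_big /=; apply: eq_bigr => a Pa.
  by rewrite -[RHS](sel (fun=> 1) a Pa); apply: eq_bigr => y _; rewrite mulr1. 
have sum_r2 : \sum_(y <- s) r y ^+ 2 = \sum_(a | P a) \sum_(b | P b) (phi a == phi b)%:R.
  under eq_bigr do rewrite expr2 {1}/r mulr_suml.
  rewrite exchange_big /=; apply: eq_bigr => a Pa; rewrite (sel r a Pa).
  by apply: eq_bigr => b _; rewrite eq_sym.
rewrite -sum_r -sum_r2; set S := \sum_(y <- s) r y; set Q := \sum_(y <- s) r y ^+ 2.
have H t : 0 <= Q - 2 * t * S + t ^+ 2 * (size s)%:R.
  have -> : Q - 2 * t * S + t ^+ 2 * (size s)%:R = \sum_(y <- s) (r y - t) ^+ 2.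
    rewrite /Q /S mulr_sumr -sumrB.
    have -> : (size s)%:R = \sum_(y <- s) (1 : R).
      by rewrite big_const_seq count_predT iter_addr addr0.
    rewrite mulr_sumr -big_split /=; apply: eq_bigr => y _; ring.
  by apply: sumr_ge0 => y _; rewrite sqr_ge0.
case: (posnP (size s)) => [s0|s0].
  by rewrite s0 mul0r /S (size0nil s0) big_nil expr0n.
have n0 : 0 < (size s)%:R :> R by rewrite ltr0n.
(* The optimal t is the mean size of the fibres. *)
have := H (S / (size s)%:R).
rewrite -(pmulr_rge0 _ n0).
have -> : (size s)%:R *
    (Q - 2 * (S / (size s)%:R) * S + (S / (size s)%:R) ^+ 2 * (size s)%:R) =
  (size s)%:R * Q - S ^+ 2.
  by field; exact: lt0r_neq0.
by rewrite subr_ge0.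
Qed.

(** * Energy of one coordinate *)

Section energy.
Context (R : realType).

Lemma powRN_le (x y b : R) : 0 <= b -> 0 < x -> x <= y -> y `^ (- b) <= x `^ (- b).
Proof.
move=> b0 x0 xy; have y0 : 0 < y by exact: lt_le_trans xy.
by rewrite !powRN lef_pV2 ?posrE ?powR_gt0// ler_powRl// ltW.
Qed.

Lemma powR_exprn (x b : R) (k : nat) : 0 <= x -> (0 < k)%N ->
  (x ^+ k) `^ (b / k%:R) = x `^ b.
Proof.
move=> x0 k0; rewrite -powR_mulrn// -powRrM mulrC divfK// pnatr_eq0.
by rewrite -lt0n.
Qed.

Lemma growth_weight_le (c g x u : R) (k : nat) : (0 < k)%N -> 0 < c -> 0 <= g -> 0 <= x ->
  c * (1 + x) ^+ k <= Num.max 1 `|u| ->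
  Num.max 1 `|u| `^ (- (g / k%:R)) <= c `^ (- (g / k%:R)) * (1 + x) `^ (- g).
Proof.
move=> k0 c0 g0 x0 H; have x1 : 0 <= 1 + x by lra.
have xk : 0 < (1 + x) ^+ k by rewrite exprn_gt0//; lra.
apply: le_trans (powRN_le _ (mulr_gt0 c0 xk) H) _.
  by rewrite divr_ge0.
by rewrite powRM ?(ltW c0) ?(ltW xk)// -mulNr powR_exprn.
Qed.

(** Each term is a multiple of [(1 + |x - y|) ^ (- g)], and there are [M] choices
    of [x]. *)
Lemma coordinate_energy (p : {poly R}) (n0 : nat) (c g : R) :
  (1 < size p)%N -> 0 < c -> 0 < g -> g != 1 ->
  (forall a b : nat, c * (1 + `|a%:R - b%:R|) ^+ (size p).-1 <=
    Num.max 1 `|p.[(n0 + a)%:R] - p.[(n0 + b)%:R]|) ->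
  exists2 C : R, 0 < C & forall m M : nat, (M <= m)%N ->
    \sum_(x < m | (x < M)%N) \sum_(y < m | (y < M)%N)
      Num.max 1 `|p.[(n0 + x)%:R] - p.[(n0 + y)%:R]| `^ (- (g / (size p).-1%:R))
    <= C * M%:R `^ (1 + Num.max 0 (1 - g)).
Proof.
move=> p1 c0 g0 g1 H; have [C C0 HC] := power_sum_le g0 g1.
have k0 : (0 < (size p).-1)%N by rewrite -ltnS (ltn_predK p1).
set k := (size p).-1 in H k0 *.
have cp : 0 < c `^ (- (g / k%:R)) by rewrite powR_gt0.
exists (c `^ (- (g / k%:R)) * (2 * C)); first by rewrite !mulr_gt0.
move=> m M Mm; rewrite (big_ord_narrow Mm) /=.
under eq_bigr do rewrite (big_ord_narrow Mm) /=.
apply: (@le_trans _ _ (\sum_(x < M) \sum_(y < M)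
    c `^ (- (g / k%:R)) * (1 + `|x - y|%N%:R) `^ (- g))).
  apply: ler_sum => x _; apply: ler_sum => y _.
  apply: growth_weight_le => //; first exact: ltW.
  have -> : `|x - y|%N%:R = `|x%:R - y%:R| :> R.
    by rewrite natr_absz intr_norm rmorphB /= -!pmulrn.
  exact: H.
under eq_bigr do rewrite -mulr_sumr.
rewrite -mulr_sumr -mulrA ler_wpM2l ?(ltW cp)//.
apply: le_trans (@pair_distance_sum_le R M (fun j => (1 + j%:R) `^ (- g)) _) _.
  by move=> j; rewrite powR_ge0.
case: M Mm => [|M] Mm.
  by rewrite big_ord0 mulr0 !mulr_ge0 ?powR_ge0// ltW.
rewrite powRD ?pnatr_eq0 ?implybT// powRr1//.
rewrite -!mulrA ler_wpM2l// [C * _]mulrCA ler_wpM2l//.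
Qed.

(** The expected number of collisions factors over the coordinates. *)
Lemma prod_pair_sum (I J : finType) (Q : I -> pred J) (F : I -> J -> J -> R) :
  \sum_(a in family Q) \sum_(b in family Q) \prod_i F i (a i) (b i) =
  \prod_i \sum_(x | Q i x) \sum_(y | Q i y) F i x y.
Proof.
rewrite bigA_distr_big_dep; apply: eq_bigr => a _.
by rewrite bigA_distr_big_dep.
Qed.

(** One more than the floor of [N ^ (1 / k)], where [N = n.+1]. *)
Definition coord_count (k n : nat) : nat := (Num.truncn (n.+1%:R `^ (k%:R^-1) : R)).+1.

Lemma coord_count_ge k n : n.+1%:R `^ (k%:R^-1) <= (coord_count k n)%:R :> R.
Proof. exact/ltW/truncnS_gt. Qed.

Lemma coord_count_le k n : (coord_count k n)%:R <= 2 * n.+1%:R `^ (k%:R^-1) :> R.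
Proof.
have h1 : 1 <= n.+1%:R `^ (k%:R^-1) :> R.
  rewrite -[leLHS](powRr0 n.+1%:R); apply: ler_powR; first by rewrite ler1n.
  by rewrite invr_ge0.
rewrite /coord_count -natr1.
have := @truncn_le R (n.+1%:R `^ (k%:R^-1)); rewrite powR_ge0.
by lra.
Qed.

Lemma coord_count_ub k n : (0 < k)%N -> (coord_count k n <= n.+2)%N.
Proof.
move=> k0; rewrite /coord_count ltnS -(@ler_nat R).
have := @truncn_le R (n.+1%:R `^ (k%:R^-1)); rewrite powR_ge0.
move/le_trans; apply; rewrite -[leRHS]powRr1//; apply: ler_powR; rewrite ?ler1n//.
by rewrite invf_le1 ?ltr0n// ler1n.
Qed.

End energy.

(** * Many floor values from few collisions *)

Lemma floor_eq_dist (R : realType) (x y : R) : Num.floor x = Num.floor y -> `|x - y| <= 1.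
Proof.
move=> xy; have := floor_le_tmp x; have := floorD1_gt x.
have := floor_le_tmp y; have := floorD1_gt y; rewrite xy intrD1 ler_norml.
move: (Num.floor y)%:~R => z; lra.
Qed.

Section lower.
Context (R : realType) (d : nat) (f : 'I_d -> {poly R}).
Hypothesis f_nonconst : forall i : 'I_d, (1 < size (f i))%N.
Variables (n0 : 'I_d -> nat) (Cu : 'I_d -> R).
Hypothesis Cu_gt0 : forall i, 0 < Cu i.
Hypothesis CuP : forall i (x : R), 0 <= x ->
  `|(f i).[x]| <= Cu i * (1 + x) ^+ (size (f i)).-1.

Let k i := (size (f i)).-1.
Let k_gt0 i : (0 < k i)%N. Proof. by rewrite -ltnS /k (ltn_predK (f_nonconst i)). Qed.
Local Notation s := (sum_inv_deg f).

(** At scale [N = n.+1] the coordinate [i] takes [coord_count (k i) n] values.  This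
    number varies with [i], so it is encoded as a predicate on a common ordinal. *)
Definition scale_range n (i : 'I_d) : pred 'I_n.+2 :=
  fun x => (x < coord_count R (k i) n)%N.
Definition scale_point m (a : {ffun 'I_d -> 'I_m}) (i : 'I_d) : int := (n0 i + a i)%N%:Z.
Definition scale_diff m (a b : {ffun 'I_d -> 'I_m}) (i : 'I_d) : R :=
  (f i).[(n0 i + a i)%:R] - (f i).[(n0 i + b i)%:R].

Lemma scale_diffE (lambda : d.-tuple R) m (a b : {ffun 'I_d -> 'I_m}) :
  linear_form f lambda (scale_point a) - linear_form f lambda (scale_point b) =
  \sum_(i < d) tnth lambda i * scale_diff a b i.
Proof.
rewrite /linear_form -sumrB; apply: eq_bigr => i _.
by rewrite -mulrBr /scale_point -!pmulrn.
Qed.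

Lemma scale_form_le (K : R) (lambda : d.-tuple R) n (a : {ffun 'I_d -> 'I_n.+2}) :
  (forall i, `|tnth lambda i| <= K) -> a \in family (@scale_range n) ->
  `|linear_form f lambda (scale_point a)| <=
    (\sum_(i < d) K * (Cu i * (n0 i).+2%:R ^+ k i)) * n.+1%:R.
Proof.
move=> lK /familyP aQ; rewrite mulr_suml; apply: le_trans (ler_norm_sum _ _ _) _.
apply: ler_sum => i _; have K0 : 0 <= K by exact: le_trans (lK i).
rewrite normrM -mulrA ler_pM// /scale_point -pmulrn.
apply: le_trans (CuP _ (ler0n _ _)) _; rewrite -mulrA ler_wpM2l ?(ltW (Cu_gt0 i))//.
set u : R := n.+1%:R `^ ((k i)%:R^-1).
have u1 : 1 <= u.
  rewrite -[leLHS](powRr0 n.+1%:R); apply: ler_powR; first by rewrite ler1n.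
  by rewrite invr_ge0.
have -> : n.+1%:R = u ^+ k i :> R.
  by rewrite -powR_mulrn ?powR_ge0// -powRrM mulVf ?powRr1// pnatr_eq0 -lt0n.
rewrite -exprMn lerXn2r ?nnegrE ?addr_ge0 ?mulr_ge0 ?powR_ge0//.
have : (a i < coord_count R (k i) n)%N by exact: aQ.
rewrite -(@ler_nat R) => ai; have := coord_count_le R (k i) n.
rewrite -/u => cu; rewrite -[(a i).+1%:R]natr1 in ai.
rewrite -[(n0 i).+2%:R]natr1 -[(n0 i).+1%:R]natr1 natrD.
have : (n0 i)%:R * 1 <= (n0 i)%:R * u by rewrite ler_wpM2l.
lra.
Qed.

(** Counting pairs at distance at most 1 dominates the number of pairs with equal
    floors, and each condition is a slab in the parameters. *)
Definition collisions n (lambda : d.-tuple R) : R :=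
  \sum_(a in family (@scale_range n)) \sum_(b in family (@scale_range n))
    (`|\sum_(i < d) tnth lambda i * scale_diff a b i| <= 1)%R%:R.

(** The vectors at scale [N = n.+1] number at least [N ^ s], and their linear forms
    are at most [W N]; two vectors with the same floor collide. *)
Lemma scale_floor_count (K : R) (lambda : d.-tuple R) n (W : R) :
  (forall i, `|tnth lambda i| <= K) ->
  W = \sum_(i < d) K * (Cu i * (n0 i).+2%:R ^+ k i) ->
  n.+1%:R `^ s ^+ 2 <=
    (floor_count (poly_sumset f lambda) ((W + 2) * n.+1%:R))%:R * collisions n lambda.
Proof.
move=> lK WE.
pose phi (a : {ffun 'I_d -> 'I_n.+2}) := Num.floor (linear_form f lambda (scale_point a)).
have N1 : 1 <= n.+1%:R :> R by rewrite ler1n.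
apply: (@le_trans _ _ ((\sum_(a in family (@scale_range n)) 1 : R) ^+ 2)).
  rewrite lerXn2r ?nnegrE ?powR_ge0 ?sumr_ge0//.
  have -> : (\sum_(a in family (@scale_range n)) 1 : R) =
      \prod_(i < d) (coord_count R (k i) n)%:R.
    transitivity (\prod_(i < d) \sum_(x | @scale_range n i x) (1 : R)).
      by rewrite bigA_distr_big_dep; apply: eq_bigr => a _; rewrite big1.
    apply: eq_bigr => i _.
    by rewrite (big_ord_narrow (coord_count_ub R n (k_gt0 i))) sumr_const card_ord.
  rewrite /sum_inv_deg powR_sumr//; apply: ler_prod => i _.
  by rewrite powR_ge0 coord_count_ge.
apply: le_trans (card_sqr_le_collisions R _ phi) _.
apply: ler_pM => //.
- by apply: sumr_ge0 => a _; apply: sumr_ge0.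
- rewrite ler_nat; apply: floor_count_ge; first exact: undup_uniq.
  move=> y; rewrite mem_undup => /mapP[a]; rewrite mem_enum => aQ ->.
  have := scale_form_le lK aQ; rewrite -WE => aW; split.
    exists (linear_form f lambda (scale_point a)) => //.
    by apply/poly_sumsetP; exists (scale_point a).
  move: aW; rewrite /phi /int_window /= ler_norml; set x := linear_form _ _ _.
  have := floor_le_tmp x; have := floorD1_gt x; rewrite intrD1.
  by move: (Num.floor x)%:~R => z; lra.
- apply: ler_sum => a _; apply: ler_sum => b _; rewrite -scale_diffE.
  by case: eqP => [/floor_eq_dist ->|].
Qed.

Variables (g : R) (Ce : 'I_d -> R).
Let tau := Num.max 0 (1 - g).
Hypothesis Ce_gt0 : forall i, 0 < Ce i.
Hypothesis CeP : forall i (m M : nat), (M <= m)%N ->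
    \sum_(x < m | (x < M)%N) \sum_(y < m | (y < M)%N)
      Num.max 1 `|(f i).[(n0 i + x)%:R] - (f i).[(n0 i + y)%:R]| `^ (- (g / (k i)%:R))
    <= Ce i * M%:R `^ (1 + tau).

(** With the slab bound, an estimate for the expected number of collisions. *)
Lemma total_energy n :
  \sum_(a in family (@scale_range n)) \sum_(b in family (@scale_range n))
     \prod_(i < d) Num.max 1 `|scale_diff a b i| `^ (- (g / (k i)%:R)) <=
  (\prod_(i < d) (Ce i * 2 `^ (1 + tau))) * n.+1%:R `^ (s * (1 + tau)).
Proof.
have t0 : 0 <= 1 + tau by rewrite addr_ge0// le_max lexx.
rewrite (prod_pair_sum (@scale_range n) (fun i (x y : 'I_n.+2) =>
  Num.max 1 `|(f i).[(n0 i + x)%:R] - (f i).[(n0 i + y)%:R]| `^ (- (g / (k i)%:R)))).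
rewrite /sum_inv_deg mulr_suml powR_sumr// -big_split /=.
apply: ler_prod => i _; apply/andP; split.
  by apply: sumr_ge0 => x _; apply: sumr_ge0 => y _; exact: powR_ge0.
apply: le_trans (CeP _ (coord_count_ub R n (k_gt0 i))) _.
rewrite -mulrA ler_wpM2l ?(ltW (Ce_gt0 i))// powRrM -powRM ?powR_ge0//.
by rewrite ler_powRl// coord_count_le.
Qed.

End lower.

(** * Positivity of the mass measure *)

(** The space is a countable union of boxes. *)
Lemma ae_from_boxes (R : realType) d (P : d.-tuple (measurableTypeR R) -> Prop) :
  (forall K : nat, {ae @lebesgue_tuple R d, forall t, box d K%:R t -> P t}) ->
  {ae @lebesgue_tuple R d, forall t, P t}.
Proof.
have [m ->] := lebesgue_tuple_measure R d.
move/ae_foralln; apply: filterS => t Pt.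
apply: (Pt (Num.truncn (\sum_(i < d) `|tnth t i|)).+1) => i.
apply: le_trans (ltW (truncnS_gt _)).
by rewrite (bigD1 i)//= lerDl sumr_ge0.
Qed.

Lemma indic_slab (R : realType) d (K L : R) (y : 'I_d -> R) t : box d K t ->
  \1_(slab K 0 L y) t = (`|\sum_(i < d) tnth t i * y i| <= L)%R%:R :> R.
Proof.
move=> Kt; rewrite indicE; congr (_%:R); congr nat_of_bool.
apply/idP/idP; first by move/set_mem => [_ /=]; rewrite add0r.
by move=> tL; apply/mem_set; split=> //=; rewrite add0r.
Qed.

Section lower_bound.
Context (R : realType) (d : nat) (f : 'I_d -> {poly R}).
Hypothesis f_nonconst : forall i : 'I_d, (1 < size (f i))%N.
Local Notation s := (sum_inv_deg f).

Lemma sum_inv_deg_ge0 : 0 <= s.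
Proof. by apply: sumr_ge0 => i _; rewrite invr_ge0. Qed.

(** Almost every [t] has [O(N ^ (s (1 + tau)))] collisions for infinitely many
    scales [N], where [tau = max(0, 1 - g)]; Cauchy-Schwarz then gives at least
    [N ^ (s (1 - tau))] floors, up to a constant, in a window of length [O(N)]. *)
Lemma ae_mass_measure_gt0_box (g : R) (K : nat) : 0 < g -> g != 1 -> g * s <= 1 ->
  {ae @lebesgue_tuple R d, forall t : d.-tuple (measurableTypeR R), box d K%:R t ->
     (0 < mass_measure (s * (1 - Num.max 0 (1 - g)))%R (poly_sumset f t))%E}.
Proof.
move=> g0 g1 gs; set tau := Num.max 0 (1 - g).
pose k i := (size (f i)).-1.
have k_gt0 i : (0 < k i)%N by rewrite -ltnS /k (ltn_predK (f_nonconst i)).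
have /choice[nc Hnc] : forall i, exists nc : nat * R, 0 < nc.2 /\ forall a b : nat,
    nc.2 * (1 + `|a%:R - b%:R|) ^+ k i <=
    Num.max 1 `|(f i).[(nc.1 + a)%:R] - (f i).[(nc.1 + b)%:R]|.
  by move=> i; have [n [c c0 H]] := poly_pair_growth (f_nonconst i); exists (n, c).
pose n0 i := (nc i).1.
have /choice[Ce HCe] : forall i, exists Ce : R, 0 < Ce /\ forall m M : nat, (M <= m)%N ->
    \sum_(x < m | (x < M)%N) \sum_(y < m | (y < M)%N)
      Num.max 1 `|(f i).[(n0 i + x)%:R] - (f i).[(n0 i + y)%:R]| `^ (- (g / (k i)%:R))
    <= Ce * M%:R `^ (1 + tau).
  move=> i; have [c0 H] := Hnc i.
  by have [C C0 HC] := coordinate_energy (f_nonconst i) c0 g0 g1 H; exists C.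
have /choice[Cu HCu] : forall i, exists Cu : R, 0 < Cu /\ forall x : R, 0 <= x ->
    `|(f i).[x]| <= Cu * (1 + x) ^+ k i.
  by move=> i; have [C C0 HC] := poly_le_growth (f i); exists C.
have [m mE] := lebesgue_tuple_measure R d; rewrite mE.
pose C0 : R := (2 * K%:R + 2) ^+ d.
have C00 : 0 < C0 by rewrite exprn_gt0// ltr_wpDl ?mulr_ge0.
pose I (n : nat) : finType := ({ffun 'I_d -> 'I_n.+2} * {ffun 'I_d -> 'I_n.+2})%type.
pose Q n := family (@scale_range R d f n).
pose N (n : nat) : R := n.+1%:R `^ (s * (1 + tau)).
have N0 n : 0 < N n by rewrite powR_gt0.
pose w n (p : I n) : R := ((p.1 \in Q n) && (p.2 \in Q n))%:R / N n.
pose A n (p : I n) := slab K%:R 0 1 (scale_diff f n0 p.1 p.2).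
pose b n (p : I n) : R :=
  C0 * \prod_(i < d) Num.max 1 `|scale_diff f n0 p.1 p.2 i| `^ (- (g / (k i)%:R)).
have sum_w n (F : {ffun 'I_d -> 'I_n.+2} -> {ffun 'I_d -> 'I_n.+2} -> R) :
    \sum_(p : I n) w n p * F p.1 p.2 = (\sum_(a in Q n) \sum_(b in Q n) F a b) / N n.
  rewrite pair_big mulr_suml [RHS]big_mkcond /=; apply: eq_bigr => p _.
  rewrite /w; case: ifP => _; first by rewrite mul1r mulrC.
  by rewrite mul0r mul0r.
have := @ae_frequently_bounded_indic _ _ R m I w b A
  (C0 * \prod_(i < d) (Ce i * 2 `^ (1 + tau))).
have w0 n p : 0 <= w n p by rewrite /w divr_ge0// ltW.
have mA n p : measurable (A n p) by exact: measurable_slab.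
have muA n p : (m (A n p) <= (b n p)%:E)%E.
  rewrite -mE; have := @lebesgue_tuple_slab_prod R d K%:R 1
    (scale_diff f n0 p.1 p.2) (fun i => g / (k i)%:R).
  rewrite powR1 mul1r -mulr_sumr; apply => // i.
  by rewrite divr_ge0// ltW.
have wC n : \sum_(p : I n) w n p * b n p <= C0 * \prod_(i < d) (Ce i * 2 `^ (1 + tau)).
  rewrite /b (sum_w n (fun a b => C0 *
    \prod_(i < d) Num.max 1 `|scale_diff f n0 a b i| `^ (- (g / (k i)%:R)))).
  under eq_bigr do rewrite -mulr_sumr.
  rewrite -mulr_sumr -mulrA ler_wpM2l ?(ltW C00)// ler_pdivrMr//.
  apply: (total_energy f_nonconst) => [i|i].
    by have [] := HCe i.
  by have [] := HCe i.
move/(_ w0 mA muA wC); apply: filterS => t [c Hc] Kt.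
pose E := poly_sumset f t.
pose W := \sum_(i < d) K%:R * (Cu i * (n0 i).+2%:R ^+ k i).
have W0 : 0 <= W.
  by apply: sumr_ge0 => i _; rewrite !mulr_ge0 ?exprn_ge0//; have [/ltW] := HCu i.
pose c' := Num.max 1 c; have c'0 : 0 < c' by rewrite lt_max ltr01.
have s0 := sum_inv_deg_ge0.
set al := s * (1 - tau).
apply: (@mass_measure_gt0 R al _ (c' * (2 * (W + 2)) `^ al)^-1).
  by rewrite invr_gt0 mulr_gt0// powR_gt0; lra.
move=> M; pose M' := (Num.truncn (Num.max 0 M)).+1.
have [n Mn] := Hc M'.
rewrite (eq_bigr (fun p : I n => w n p *
  (`|\sum_(i < d) tnth t i * scale_diff f n0 p.1 p.2 i| <= 1)%R%:R)); last first.
  by move=> p _; rewrite indic_slab.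
rewrite (sum_w n (fun a b => (`|\sum_(i < d) tnth t i * scale_diff f n0 a b i| <= 1)%R%:R)).
rewrite ler_pdivrMr// => Hn.
have Hcol : collisions f n0 n t <= c' * N n.
  by apply: le_trans Hn _; rewrite ler_wpM2r ?(ltW (N0 n))// le_max lexx orbT.
set S : R := n.+1%:R.
have S0 : 0 < S by rewrite ltr0n.
exists ((W + 2) * S).
  (* The scale n is chosen beyond M, hence so is the window. *)
  have MS : M < S.
    have : Num.max 0 M < M'%:R by exact: truncnS_gt.
    rewrite gt_max => /andP[_ MM]; apply: lt_le_trans MM _.
    by rewrite ler_nat (leq_trans Mn).
  apply: lt_le_trans MS _; rewrite ler_peMl ?(ltW S0)//; lra.
have := scale_floor_count f_nonconst (fun i => (HCu i).1) (fun i => (HCu i).2) n Kt (erefl W).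
rewrite -/E -/S => HF.
set F : R := (floor_count E _)%:R in HF *.
have F0 : 0 <= F by [].
have HS : S `^ al * N n = S `^ s ^+ 2.
  rewrite /N -/S -powRD ?(gt_eqF S0) ?implybT//.
  rewrite -powR_mulrn ?powR_ge0// -powRrM; congr (_ `^ _); rewrite /al; ring.
have HF2 : S `^ al <= F * c'.
  rewrite -(ler_pM2r (N0 n)) HS -mulrA; apply: le_trans HF _.
  by rewrite ler_wpM2l.
have -> : 2 * ((W + 2) * S) = 2 * (W + 2) * S by ring.
set v := 2 * (W + 2); have v0 : 0 < v by rewrite /v; lra.
rewrite (powRM _ (ltW v0) (ltW S0)); set q := v `^ al.
have q0 : 0 < q by rewrite powR_gt0.
have Sal0 : 0 < S `^ al by rewrite powR_gt0.
rewrite ler_pdivlMr ?mulr_gt0// invfM mulrA -[_ / q * q]mulrA mulVf ?gt_eqF// mulr1.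
by rewrite ler_pdivrMl// mulrC.
Qed.

Lemma ae_mass_measure_gt0 (g : R) : 0 < g -> g != 1 -> g * s <= 1 ->
  {ae @lebesgue_tuple R d, forall t : d.-tuple (measurableTypeR R),
     (0 < mass_measure (s * (1 - Num.max 0 (1 - g)))%R (poly_sumset f t))%E}.
Proof. by move=> g0 g1 gs; apply: ae_from_boxes => K; exact: ae_mass_measure_gt0_box. Qed.

End lower_bound.

(** * The upper bound for the mass dimension *)

Section upper_bound.
Context (R : realType) (d : nat) (f : 'I_d -> {poly R}).
Hypothesis f_nonconst : forall i : 'I_d, (1 < size (f i))%N.
Local Notation s := (sum_inv_deg f).

(** Integers as pairs of a sign and an absolute value; zero is represented twice,
    which is harmless for upper bounds. *)
Definition signed (m : nat) (p : bool * 'I_m) : int :=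
  if p.1 then - (p.2 : nat)%:Z else (p.2 : nat)%:Z.

Lemma norm_signed m (p : bool * 'I_m) : `|(signed p)%:~R| = (p.2 : nat)%:R :> R.
Proof. by case: p => [[] j]; rewrite /signed /= ?rmorphN ?normrN /= -pmulrn normr_nat. Qed.

Lemma geometric_sum_le (r : R) n : 0 < r < 1 -> \sum_(j < n) r ^+ j <= (1 - r)^-1.
Proof.
move=> /andP[r0 r1]; have r10 : 0 < 1 - r by rewrite subr_gt0.
rewrite -[leRHS]mul1r ler_pdivlMr// mulrC.
have -> : (1 - r) * \sum_(j < n) r ^+ j = 1 - r ^+ n.
  by rewrite -opprB mulNr -subrX1 opprB.
by rewrite gerBl exprn_ge0// ltW.
Qed.

(** The terms are [O((1 + |n|) ^ (- g))] with [g > 1]. *)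
Lemma coordinate_weight_sum (p : {poly R}) (g : R) : (1 < size p)%N -> 1 < g ->
  exists2 C : R, 0 < C & forall m : nat,
    \sum_(x : bool * 'I_m) Num.max 1 `|p.[(signed x)%:~R]| `^ (- (g / (size p).-1%:R)) <= C.
Proof.
move=> p1 g1; have [c c0 Hc] := poly_int_growth p1.
have g0 : 0 < g by lra.
have [C C0 HC] := power_sum_le g0 (negbT (gt_eqF g1)).
have k0 : (0 < (size p).-1)%N by rewrite -ltnS (ltn_predK p1).
exists (c `^ (- (g / (size p).-1%:R)) * (2 * C)); first by rewrite !mulr_gt0// powR_gt0.
move=> m.
apply: (@le_trans _ _ (\sum_(x : bool * 'I_m)
    c `^ (- (g / (size p).-1%:R)) * (1 + (x.2 : nat)%:R) `^ (- g))).
  apply: ler_sum => x _; apply: growth_weight_le => //; first exact: ltW.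
  by rewrite -(norm_signed x).
rewrite -mulr_sumr ler_wpM2l ?powR_ge0//.
rewrite -(pair_bigA _ (fun (_ : bool) (j : 'I_m) => (1 + (j : nat)%:R) `^ (- g))) /=.
rewrite sumr_const card_bool -[leLHS]mulr_natl ler_wpM2l//.
apply: le_trans (HC m) _; rewrite (_ : Num.max 0 (1 - g) = 0) ?powRr0 ?mulr1//.
by apply/max_idPl; lra.
Qed.

Lemma dyadic_between (l : R) : 1 <= l -> exists e : nat, l + 1 <= 2 ^+ e /\ 2 ^+ e <= 4 * l.
Proof.
move=> l1; pose t := Num.truncn l; exists (trunc_log 2 t).+2.
have t1 : (0 < t)%N by rewrite truncn_gt0.
have /andP[t2 t3] := trunc_log_bounds (isT : (1 < 2)%N) t1.
have tl : t%:R <= l by rewrite truncn_le//; lra.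
have lt : l < t.+1%:R by exact: truncnS_gt.
rewrite -!natrX; split.
  have : (t.+2 <= 2 ^ (trunc_log 2 t).+2)%N by rewrite expnS; lia.
  by rewrite -(@ler_nat R) -[t.+2%:R]natr1; lra.
have : (2 ^ (trunc_log 2 t).+2 <= 4 * t)%N by rewrite !expnS; lia.
by rewrite -(@ler_nat R) natrM; lra.
Qed.

Definition signed_value m (h : {ffun 'I_d -> bool * 'I_m}) (i : 'I_d) : R :=
  (f i).[(signed (h i))%:~R].

(** Each floor value in the window comes from an integer vector whose linear form
    is at most [l + 1] in absolute value.  Finitely many vectors are involved, so
    they all lie in a large enough cube. *)
Lemma floor_count_le_weight (t : d.-tuple R) (l L : R) : l + 1 <= L ->
  exists B : nat, forall n, (B <= n)%N ->
    (floor_count (poly_sumset f t) l)%:R <=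
    \sum_(h : {ffun 'I_d -> bool * 'I_n.+1})
       (`|\sum_(i < d) tnth t i * signed_value h i| <= L)%R%:R :> R.
Proof.
move=> lL; pose V := floor_set (poly_sumset f t) `&` int_window l.
have /choice[z Hz] : forall v : int, exists z : 'I_d -> int, V v ->
    Num.floor (linear_form f t z) = v.
  move=> v; case: (pselect (V v)) => [[[x /poly_sumsetP[z ->] xv] _]|nV]; first by exists z.
  by exists (fun=> 0).
pose F := fset_set V.
have FV v : v \in F -> V v by move/mem_floor_window.
pose B := \max_(v <- F) \max_(i < d) absz (z v i).
exists B => n Bn.
have zB v i : v \in F -> (absz (z v i) < n.+1)%N.
  move=> vF; rewrite ltnS; apply: leq_trans Bn.
  apply: leq_trans (leq_bigmax_seq _ vF _) => //.
  exact: (leq_bigmax i).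
pose h (v : int) : {ffun 'I_d -> bool * 'I_n.+1} :=
  [ffun i => ((z v i < 0)%R, inord (absz (z v i)))].
have hz v i : v \in F -> signed (h v i) = z v i.
  by move=> vF; rewrite /signed /h ffunE /= inordK ?zB//; case: ifP; lia.
have hE v : v \in F -> \sum_(i < d) tnth t i * signed_value (h v) i = linear_form f t (z v).
  by move=> vF; apply: eq_bigr => i _; rewrite /signed_value hz.
have hI : {in F &, injective h}.
  move=> u v uF vF uv; rewrite -(Hz u (FV _ uF)) -(Hz v (FV _ vF)).
  by rewrite -!hE// uv.
apply: (@le_trans _ _ (\sum_(g <- [seq h v | v <- F]) (1 : R))).
  by rewrite big_map big_const_seq count_predT iter_addr addr0.
rewrite big_uniq /=; last by rewrite map_inj_in_uniq// fset_uniq.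
rewrite big_mkcond /=; apply: ler_sum => g _; case: ifP => // /mapP[v vF ->].
rewrite hE// (_ : _ <= L)%R //=.
have [_ /andP[vl lv]] := FV _ vF.
have := floor_le_tmp (linear_form f t (z v)); have := floorD1_gt (linear_form f t (z v)).
rewrite intrD1 (Hz v (FV _ vF)).
by move: v%:~R (linear_form _ _ _) vl lv => y x ? ? ? ?; rewrite ler_norml; lra.
Qed.

(** With [L = 2 ^ j], the expectation of
    [sum_j L ^ (- a) #{n | |t . f(n)| <= L}] over the box is finite, since the
    expected count at scale [L] is [O(L ^ (g s))] and [g s < a].  For almost every
    [t] the count is therefore [O(L ^ a)] at all scales.  The sums are truncated to
    finite cubes; being bounded for infinitely many of them is enough, as every
    finite family of vectors lies in all large cubes. *)
Lemma ae_mass_dimension_le_box (a : R) (K : nat) : s < a -> a <= 1 ->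
  {ae @lebesgue_tuple R d, forall t : d.-tuple (measurableTypeR R), box d K%:R t ->
     mass_dimension (poly_sumset f t) <= a}.
Proof.
move=> sa a1; have s0 := sum_inv_deg_ge0 f; have a0 : 0 < a by exact: le_lt_trans sa.
pose g := 1 + (a - s) / 2; have g1 : 1 < g by rewrite /g; lra.
pose al := g * s; have al_lt : al < a by rewrite /al /g; nra.
have al0 : 0 <= al by rewrite mulr_ge0//; lra.
pose k i := (size (f i)).-1.
have /choice[Cw HCw] : forall i, exists C : R, 0 < C /\ forall m : nat,
    \sum_(x : bool * 'I_m) Num.max 1 `|(f i).[(signed x)%:~R]| `^ (- (g / (k i)%:R)) <= C.
  by move=> i; have [C C0 HC] := coordinate_weight_sum (f_nonconst i) g1; exists C.
have [m mE] := lebesgue_tuple_measure R d; rewrite mE.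
pose C0 : R := (2 * K%:R + 2) ^+ d.
have C00 : 0 < C0 by rewrite exprn_gt0// ltr_wpDl ?mulr_ge0.
pose I (n : nat) : finType := ('I_n.+1 * {ffun 'I_d -> bool * 'I_n.+1})%type.
pose L (j : nat) : R := 2 ^+ j.
have L1 j : 1 <= L j by rewrite exprn_ege1// ler1n.
have L0 j : 0 < L j by rewrite exprn_gt0.
pose w n (p : I n) : R := L p.1 `^ (- a).
pose A n (p : I n) := slab K%:R 0 (L p.1) (signed_value p.2).
pose b n (p : I n) : R := C0 * (L p.1 `^ al *
  \prod_(i < d) Num.max 1 `|signed_value p.2 i| `^ (- (g / (k i)%:R))).
have w0 n p : 0 <= w n p by exact: powR_ge0.
have mA n p : measurable (A n p) by exact: measurable_slab.
have alE : \sum_(i < d) g / (k i)%:R = al by rewrite -mulr_sumr.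
have muA n p : (m (A n p) <= (b n p)%:E)%E.
  rewrite -mE; have := @lebesgue_tuple_slab_prod R d K%:R (L p.1)
    (signed_value p.2) (fun i => g / (k i)%:R).
  rewrite alE; apply => //; last by lra.
  by move=> i; rewrite divr_ge0//; lra.
pose r : R := 2 `^ (al - a).
have r01 : 0 < r < 1.
  rewrite /r powR_gt0//=; have -> : al - a = - (a - al) by ring.
  rewrite powRN invf_lt1 ?powR_gt0//.
  have := @gt0_ltr_powR R (a - al) _ 1 2; rewrite powR1; apply; rewrite ?nnegrE//.
    by rewrite subr_gt0.
  by rewrite ltr1n.
have wC n : \sum_(p : I n) w n p * b n p <= C0 * ((1 - r)^-1 * \prod_(i < d) Cw i).
  pose X (j : 'I_n.+1) := r ^+ j.
  pose Y (h : {ffun 'I_d -> bool * 'I_n.+1}) :=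
    \prod_(i < d) Num.max 1 `|signed_value h i| `^ (- (g / (k i)%:R)).
  have -> : \sum_(p : I n) w n p * b n p = C0 * ((\sum_j X j) * (\sum_h Y h)).
    rewrite big_distrlr pair_bigA mulr_sumr; apply: eq_bigr => p _ /=.
    rewrite /w /b /X mulrCA; congr (_ * _); rewrite mulrA; congr (_ * _).
    rewrite -powRD ?(gt_eqF (L0 _)) ?implybT// addrC /L /r.
    by rewrite -!powR_mulrn ?powR_ge0// -!powRrM mulrC.
  rewrite ler_wpM2l ?(ltW C00)//; apply: ler_pM.
  - by apply: sumr_ge0 => j _; rewrite exprn_ge0// powR_ge0.
  - by apply: sumr_ge0 => h _; apply: prodr_ge0 => i _; exact: powR_ge0.
  - exact: geometric_sum_le.
  rewrite /Y /signed_value -(bigA_distr_bigA (fun i (x : bool * 'I_n.+1) =>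
    Num.max 1 `|(f i).[(signed x)%:~R]| `^ (- (g / (k i)%:R)))).
  apply: ler_prod => i _; rewrite (HCw i).2 andbT.
  by apply: sumr_ge0 => x _; exact: powR_ge0.
have := ae_frequently_bounded_indic w0 mA muA wC.
apply: filterS => t [c Hc] Kt.
apply: (@mass_dimension_le R a (Num.max 0 c * 4 `^ a)); first exact: ltW.
  by rewrite mulr_ge0 ?powR_ge0// le_max lexx.
move=> l l1; have [e [le1 le4]] := dyadic_between l1.
have [B HB] := floor_count_le_weight t le1.
have [n /[!geq_max] /andP[Bn en]] := Hc (maxn B e).
have en' : (e < n.+1)%N by [].
pose T := \sum_(h : {ffun 'I_d -> bool * 'I_n.+1})
       (`|\sum_(i < d) tnth t i * signed_value h i| <= L e)%R%:R : R.
move=> Hn; have : L e `^ (- a) * T <= Num.max 0 c.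
  apply: le_trans (_ : c <= _); last by rewrite le_max lexx orbT.
  apply: le_trans Hn.
  rewrite -(pair_bigA _ (fun (j : 'I_n.+1) (h : {ffun 'I_d -> bool * 'I_n.+1}) =>
     w n (j, h) * \1_(A n (j, h)) t)) /=.
  rewrite (bigD1 (Ordinal en'))//= ler_wpDr//.
    by apply: sumr_ge0 => j _; apply: sumr_ge0 => h _; rewrite mulr_ge0.
  rewrite /T mulr_sumr le_eqVlt; apply/orP; left; apply/eqP.
  by apply: eq_bigr => h _; rewrite /w /A /= indic_slab.
rewrite powRN ler_pdivrMl ?powR_gt0// => HT.
apply: le_trans (HB n Bn) _; apply: le_trans HT _.
rewrite mulrC -mulrA ler_wpM2l ?le_max ?lexx//.
by rewrite -powRM//; [rewrite ler_powRl ?(ltW a0) ?(ltW (L0 e)) | lra].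
Qed.

Lemma ae_mass_dimension_le (a : R) : s < a -> a <= 1 ->
  {ae @lebesgue_tuple R d, forall t : d.-tuple (measurableTypeR R),
     mass_dimension (poly_sumset f t) <= a}.
Proof. by move=> sa a1; apply: ae_from_boxes => K; exact: ae_mass_dimension_le_box. Qed.

End upper_bound.

(** * The theorem *)

Lemma ler_all_harmonic (R : realType) (x y c : R) : 0 < c ->
  (forall n : nat, x <= y + c / n.+1%:R) -> x <= y.
Proof.
move=> c0 H; apply/ler_addgt0Pr => e e0.
apply: le_trans (H (Num.truncn (c / e))) _; rewrite lerD2l ler_pdivrMr ?ltr0n//.
by rewrite mulrC -ler_pdivrMr// ltW// truncnS_gt.
Qed.

(** If [s < 1], the choice [g = 2 - s > 1] gives the exponent [s], and
    [g s = 1 - (1 - s) ^ 2 <= 1].  If [s > 1], the choice [g = 1 / s < 1] gives the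
    exponent [s g = 1]. *)
Lemma ae_mass_measure_min_gt0 (R : realType) (d : nat) (f : 'I_d -> {poly R}) :
  (forall i : 'I_d, (1 < size (f i))%N) -> sum_inv_deg f != 1 ->
  {ae @lebesgue_tuple R d, forall t : d.-tuple (measurableTypeR R),
     (0 < mass_measure (Num.min 1 (sum_inv_deg f))%R (poly_sumset f t))%E}.
Proof.
move=> f1 s1; have s0 := sum_inv_deg_ge0 f.
set s := sum_inv_deg f in s0 s1 *.
case: (ltgtP s 1) s1 => // [s_lt1 _|s_gt1 _].
  have -> : s = s * (1 - Num.max 0 (1 - (2 - s))) :> R.
    by have -> : Num.max 0 (1 - (2 - s)) = 0 by [apply/max_idPl; lra]; ring.
  apply: ae_mass_measure_gt0 => //; first by lra.
    by apply/eqP; lra.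
  rewrite -/s; have := sqr_ge0 (1 - s); lra.
have s_gt0 : 0 < s by lra.
have -> : 1 = s * (1 - Num.max 0 (1 - s^-1)) :> R.
  have -> : Num.max 0 (1 - s^-1) = 1 - s^-1.
    by apply/max_idPr; rewrite subr_ge0 invf_le1// ltW.
  by rewrite opprB addrC subrK mulfV// gt_eqF.
apply: ae_mass_measure_gt0 => //; first by rewrite invr_gt0.
  by rewrite lt_eqF// invf_lt1.
by rewrite -/s mulVf// gt_eqF.
Qed.

(** For [s = 1], take [g = 1 - e] with [e] tending to 0. *)
Lemma ae_mass_dimension_ge (R : realType) (d : nat) (f : 'I_d -> {poly R}) :
  (forall i : 'I_d, (1 < size (f i))%N) ->
  {ae @lebesgue_tuple R d, forall t : d.-tuple (measurableTypeR R),
     Num.min 1 (sum_inv_deg f) <= mass_dimension (poly_sumset f t)}.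
Proof.
move=> f1; have [m mE] := lebesgue_tuple_measure R d.
have [s1|s1] := eqVneq (sum_inv_deg f) 1; last first.
  have := ae_mass_measure_min_gt0 f1 s1; rewrite mE.
  by apply: filterS => t; exact: mass_dimension_ge.
rewrite s1 minxx.
have : forall n : nat, {ae @lebesgue_tuple R d, forall t : d.-tuple (measurableTypeR R),
    1 <= mass_dimension (poly_sumset f t) + 2^-1 / n.+1%:R}.
  move=> n; pose e : R := 2^-1 / n.+1%:R.
  have e0 : 0 < e by rewrite divr_gt0.
  have e1 : e < 1.
    rewrite ltr_pdivrMr// mul1r; apply: lt_le_trans (_ : 1 <= _); last by rewrite ler1n.
    lra.
  have := @ae_mass_measure_gt0 R d f f1 (1 - e); rewrite s1 mul1r mE.
  have -> : Num.max 0 (1 - (1 - e)) = e by rewrite subKr; apply/max_idPr; exact: ltW.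
  move=> H; have : {ae m, forall t : d.-tuple (measurableTypeR R),
      (0 < mass_measure (1 - e)%R (poly_sumset f t))%E}.
    by apply: H; [lra | apply/eqP; lra | lra].
  by apply: filterS => t /mass_dimension_ge; rewrite lerBlDr.
rewrite mE => /ae_foralln; apply: filterS => t Ht.
by apply: (@ler_all_harmonic R _ _ 2^-1) => //.
Qed.

Lemma ae_mass_dimension_le_min (R : realType) (d : nat) (f : 'I_d -> {poly R}) :
  (forall i : 'I_d, (1 < size (f i))%N) ->
  {ae @lebesgue_tuple R d, forall t : d.-tuple (measurableTypeR R),
     mass_dimension (poly_sumset f t) <= Num.min 1 (sum_inv_deg f)}.
Proof.
move=> f1; have [m mE] := lebesgue_tuple_measure R d.
have [s1|s1] := leP 1 (sum_inv_deg f).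
  by rewrite mE; apply: aeW => t; exact: mass_dimension_le1.
have c0 : 0 < 1 - sum_inv_deg f by rewrite subr_gt0.
have : forall n : nat, {ae @lebesgue_tuple R d, forall t : d.-tuple (measurableTypeR R),
    mass_dimension (poly_sumset f t) <= sum_inv_deg f + (1 - sum_inv_deg f) / n.+1%:R}.
  move=> n; apply: ae_mass_dimension_le => //; first by rewrite ltrDl divr_gt0.
  rewrite addrC -lerBrDr ler_pdivrMr// ler_peMr ?(ltW c0)// ler1n//.
rewrite mE => /ae_foralln; apply: filterS => t Ht.
exact: (ler_all_harmonic c0).
Qed.

Theorem corollaryF (R : realType) (d : nat) (f : 'I_d -> {poly R})
    (f_nonconst : forall i : 'I_d, (1 < size (f i))%N) :
  {ae @lebesgue_tuple R d, forall lambda : d.-tuple (measurableTypeR R),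
     mass_dimension (poly_sumset f lambda) = Num.min 1 (sum_inv_deg f)} /\
  (sum_inv_deg f <> 1 ->
   {ae @lebesgue_tuple R d, forall lambda : d.-tuple (measurableTypeR R),
     (0 < mass_measure (Num.min 1 (sum_inv_deg f))%R
            (poly_sumset f lambda))%E}).
Proof.
split; last by move=> /eqP; exact: ae_mass_measure_min_gt0.
have := ae_mass_dimension_le_min f_nonconst; have := ae_mass_dimension_ge f_nonconst.
have [m ->] := lebesgue_tuple_measure R d.
by apply: filterS2 => t ge_t le_t; apply/eqP; rewrite eq_le le_t.
Qed.
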